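(* Let $T>0$, $A,C\in\mathbb{R}^{n\times n}$, $B,D\in\mathbb{R}^{n\times m}$, $Q\in\mathbb{S}^n$ with $Q\geq 0$, and $R\in\mathbb{S}^m$ with $R>0$. Assume that the system $[A,B;C,D]$ is $L^2$-stabilizable. If the delayed Riccati equation $$ \begin{cases} \dot\Sigma(s)+\Sigma(s)[A+B\Psi]+[A+B\Psi]^{\mathrm T}\Sigma(s)+[C+D\Psi]^{\mathrm T}\Sigma(s)[C+D\Psi]+Q+\Psi^{\mathrm T}R\Psi=0,\quad 0\leq s\leq T,\\ \Sigma(T)=0, \end{cases} $$ with $$ \Psi=-[R+D^{\mathrm T}\Sigma(0)D]^{-1}[B^{\mathrm T}\Sigma(0)+D^{\mathrm T}\Sigma(0)C], $$ admits a solution $\Sigma(\cdot)$, then $0\leq\Sigma(0)\leq P_\infty$, where $P_\infty\in\mathbb{S}^n_+$ is the unique static stabilizing solution of the algebraic Riccati equation $$A^{\mathrm T}P+PA+C^{\mathrm T}PC+Q-(B^{\mathrm T}P+D^{\mathrm T}PC)^{\mathrm T}(R+D^{\mathrm T}PD)^{-1}(B^{\mathrm T}P+D^{\mathrm T}PC)=0.$$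
   Context: $\mathbb{S}^n$ is the space of real symmetric $n\times n$ matrices, $\mathbb{S}^n_+$ the subset of positive semidefinite ones; $M\geq N$ (resp. $M>N$) means $M-N$ is positive semidefinite (resp. positive definite). $W$ is a one-dimensional standard Brownian motion. A solution of the delayed Riccati equation is a symmetric-matrix-valued function $\Sigma(\cdot)$ on $[0,T]$, with $R+D^{\mathrm T}\Sigma(0)D$ invertible, satisfying the equation with the constant matrix $\Psi$ determined by the value $\Sigma(0)$ of the unknown itself. For $A',C'\in\mathbb{R}^{n\times n}$, the system $[A';C']$ is $L^2$-stable if for every $x\in\mathbb{R}^n$ the solution of $dX(s)=A'X(s)ds+C'X(s)dW(s)$, $s\geq0$, $X(0)=x$, satisfies $\mathbb E\int_0^\infty|X(s)|^2ds<\infty$. The system $[A,B;C,D]$ is $L^2$-stabilizable if there is $\Theta\in\mathbb{R}^{m\times n}$ such that $[A+B\Theta;C+D\Theta]$ is $L^2$-stable; such a $\Theta$ is called a stabilizer of $[A,B;C,D]$. A matrix $P\in\mathbb{S}^n$ is a static stabilizing solution of the algebraic Riccati equation if it satisfies that equation and $-(R+D^{\mathrm T}PD)^{-1}(B^{\mathrm T}P+D^{\mathrm T}PC)$ is a stabilizer of $[A,B;C,D]$. It is known that if $Q\geq0$, $R>0$ and $[A,B;C,D]$ is $L^2$-stabilizable, then there is a unique static stabilizing solution $P_\infty$, and it lies in $\mathbb{S}^n_+$. *)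

(* Defs.v *)
From HB Require Import structures.
From mathcomp Require Import all_boot all_order all_algebra.
From mathcomp Require Import all_classical all_reals all_analysis.

Set Implicit Arguments.
Unset Strict Implicit.
Unset Printing Implicit Defensive.

Import Order.TTheory GRing.Theory Num.Theory.
Import numFieldNormedType.Exports.

Local Open Scope classical_set_scope.
Local Open Scope ring_scope.

Section Loewner.
Context {K : realType}.

Definition psd n (M : 'M[K]_n) : Prop :=
  M^T = M /\ forall x : 'cV[K]_n, 0 <= (x^T *m M *m x) 0 0.

Definition posdef n (M : 'M[K]_n) : Prop :=
  M^T = M /\ forall x : 'cV[K]_n, x != 0 -> 0 < (x^T *m M *m x) 0 0.

Definition loewner_le n (N M : 'M[K]_n) : Prop := psd (M - N).

(* |x|^2 for the Euclidean norm; the library norm on matrices is the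
   maximum norm. *)
Definition sqnorm n (x : 'cV[K]_n) : K := \sum_i x i 0 ^+ 2.

End Loewner.

Section StochasticCalculus.
Context {K : realType} {d : measure_display} {Omega : measurableType d}.
Variables (P : probability Omega K) (F : K -> set (set Omega)).

(* Only the values at times t >= 0 of F and of the processes below matter. *)
Definition filtration : Prop :=
  [/\ forall t : K, 0 <= t -> sigma_algebra setT (F t),
      forall t : K, 0 <= t -> F t `<=` measurable,
      forall s t : K, 0 <= s -> s <= t -> F s `<=` F t
    & forall (t : K) (N : set Omega), 0 <= t -> measurable N -> P N = 0%E -> F t N].

Definition measurable_at (t : K) (Z : Omega -> K) : Prop :=
  forall B : set K, measurable B -> F t (Z @^-1` B).

Definition adapted (Y : K -> Omega -> K) : Prop :=
  forall t : K, 0 <= t -> measurable_at t (Y t).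

(* Standard one-dimensional Brownian motion with respect to F.  The second
   argument of normal_prob is the standard deviation. *)
Definition brownian_motion (W : K -> Omega -> K) : Prop :=
  [/\ adapted W,
      {ae P, forall w, W 0 w = 0},
      {ae P, forall w, {within `[0, +oo[, continuous (fun t => W t w)}},
      forall (s t : K) (B : set K), 0 <= s -> s < t -> measurable B ->
        P ((fun w => W t w - W s w) @^-1` B) =
        normal_prob 0 (Num.sqrt (t - s)) B
    & forall (s t : K) (B : set K) (E : set Omega),
        0 <= s -> s < t -> measurable B -> F s E ->
        P (E `&` ((fun w => W t w - W s w) @^-1` B)) =
        (P E * P ((fun w => W t w - W s w)%R @^-1` B))%E].

(* Simple integrands: sum over i < k of xi_i 1_(t_i, t_(i+1)], with xi_i
   bounded and F_(t_i)-measurable. *)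
Record simple_process := SimpleProcess {
  sp_size : nat;
  sp_time : nat -> K;
  sp_coef : nat -> Omega -> K;
  sp_time0 : 0 <= sp_time 0;
  sp_time_homo : forall i, sp_time i <= sp_time i.+1;
  sp_coef_meas : forall i, measurable_at (sp_time i) (sp_coef i);
  sp_coef_bounded : forall i, exists M, forall w, `|sp_coef i w| <= M
}.

Definition sp_val (H : simple_process) (s : K) (w : Omega) : K :=
  \sum_(i < sp_size H)
    sp_coef H i w * \1_(`]sp_time H i, sp_time H i.+1]) s.

Definition sp_integral (W : K -> Omega -> K) (H : simple_process)
    (t : K) (w : Omega) : K :=
  \sum_(i < sp_size H)
    sp_coef H i w *
    (W (Num.min t (sp_time H i.+1)) w - W (Num.min t (sp_time H i)) w).

(* I is (a version of) the Ito integral of Y against W over [0, t]: the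
   L^2 limit of the integrals of simple processes H k that approximate Y in
   L^2([0, t] x Omega). *)
Definition is_ito_integral (W Y : K -> Omega -> K) (t : K) (I : Omega -> K)
    : Prop :=
  [/\ measurable_fun [set p : measurableTypeR K * Omega | 0 <= p.1]
        (fun p : measurableTypeR K * Omega => Y p.1 p.2),
      adapted Y,
      measurable_fun setT I
    & exists H : nat -> simple_process,
        (fun k => \int[P]_w \int[lebesgue_measure]_(s in `[0%R, t])
            ((sp_val (H k) s w - Y s w) ^+ 2)%R%:E)%E @ \oo --> 0%E /\
        (fun k => \int[P]_w
            ((sp_integral W (H k) t w - I w) ^+ 2)%R%:E)%E @ \oo --> 0%E].

(* X solves dX = A X ds + C X dW on [0, +oo[, X(0) = x. *)
Definition sde_solution (W : K -> Omega -> K) n (A C : 'M[K]_n)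
    (x : 'cV[K]_n) (X : K -> Omega -> 'cV[K]_n) : Prop :=
  [/\ forall i, adapted (fun t w => X t w i 0),
      forall w, {within `[0, +oo[, continuous (fun t => X t w)}
    & forall (t : K) (i : 'I_n), 0 <= t -> exists2 I : Omega -> K,
        is_ito_integral W (fun s w => (C *m X s w) i 0) t I &
        {ae P, forall w, X t w i 0 =
          x i 0 + Rintegral lebesgue_measure `[0, t]
                    (fun s => (A *m X s w) i 0) + I w}].

(* The solution of the equation is unique up to indistinguishability, so
   asking the integrability of some solution is asking it of the solution. *)
Definition L2_stable (W : K -> Omega -> K) n (A C : 'M[K]_n) : Prop :=
  forall x : 'cV[K]_n, exists2 X : K -> Omega -> 'cV[K]_n,
    sde_solution W A C x X &
    (\int[P]_w \int[lebesgue_measure]_(s in `[0%R, +oo[)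
       (sqnorm (X s w))%:E < +oo)%E.

Definition stabilizer (W : K -> Omega -> K) n m (A C : 'M[K]_n)
    (B D : 'M[K]_(n, m)) (Theta : 'M[K]_(m, n)) : Prop :=
  L2_stable W (A + B *m Theta) (C + D *m Theta).

Definition L2_stabilizable (W : K -> Omega -> K) n m (A C : 'M[K]_n)
    (B D : 'M[K]_(n, m)) : Prop :=
  exists Theta : 'M[K]_(m, n), stabilizer W A C B D Theta.

End StochasticCalculus.

Section Riccati.
Context {K : realType} {n m : nat}.
Variables (A C : 'M[K]_n) (B D : 'M[K]_(n, m)) (Q : 'M[K]_n) (R : 'M[K]_m).

Definition gain (P : 'M[K]_n) : 'M[K]_(m, n) :=
  - (invmx (R + D^T *m P *m D) *m (B^T *m P + D^T *m P *m C)).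

(* The derivative is taken within [0, T], hence is one-sided at 0 and T. *)
Definition delayed_riccati_solution (T : K) (Sigma : K -> 'M[K]_n) : Prop :=
  let Psi := gain (Sigma 0) in
  [/\ forall s : K, 0 <= s <= T -> (Sigma s)^T = Sigma s,
      R + D^T *m Sigma 0 *m D \in unitmx,
      forall s : K, 0 <= s <= T -> exists2 dSigma : 'M[K]_n,
        (fun r => (r - s)^-1 *: (Sigma r - Sigma s))
          @ within `[0, T] s^' --> dSigma &
        dSigma + Sigma s *m (A + B *m Psi) + (A + B *m Psi)^T *m Sigma s
          + (C + D *m Psi)^T *m Sigma s *m (C + D *m Psi)
          + Q + Psi^T *m R *m Psi = 0
    & Sigma T = 0].

Definition riccati_equation (P : 'M[K]_n) : Prop :=
  A^T *m P + P *m A + C^T *m P *m C + Q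
    - (B^T *m P + D^T *m P *m C)^T *m invmx (R + D^T *m P *m D)
        *m (B^T *m P + D^T *m P *m C) = 0.

Definition static_stabilizing_solution {d : measure_display}
    {Omega : measurableType d} (Pr : probability Omega K)
    (F : K -> set (set Omega)) (W : K -> Omega -> K) (P : 'M[K]_n) : Prop :=
  [/\ P^T = P,
      R + D^T *m P *m D \in unitmx,
      riccati_equation P
    & stabilizer Pr F W A C B D (gain P)].

End Riccati.

(* Main.v *)
Require Import Defs.
From mathcomp Require Import all_boot all_order all_algebra.
From mathcomp Require Import all_classical all_reals all_analysis.
From mathcomp Require Import measurable_realfun ring lra.

(** The matrix [Sigma] solves, for the constant feedback [Psi], a linear backward
    Lyapunov equation with nonnegative source and zero final value. Hence it is
    nonnegative and decreases with time (lyapunov_backward). At time zero this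
    says that the Lyapunov expression of [Sigma 0] for [Psi] is nonnegative; since
    [Psi] is the gain of [Sigma 0], completing the square (complete_square)
    identifies this expression with the algebraic Riccati expression. So
    [Sigma 0] is a nonnegative subsolution of the algebraic Riccati equation.

    Let [Theta] be the gain of [Pinf]. Completing the square for [Pinf] and for
    [Sigma 0] with this same feedback shows that [Delta = Pinf - Sigma 0] has a
    nonpositive Lyapunov expression for the closed-loop system. This system is
    stable, and stability forces [Delta] to be nonnegative (L2_stable_lyapunov):
    along a solution [X], the expectation of the quadratic form of [Delta] at
    [X t] does not increase with [t], and it tends to zero along some times
    because the second moments are integrable over the half-line.

    The monotonicity rests on the evolution of second moments, which is Ito's
    formula for quadratic functions. It is derived from the definition of the
    integral as an L2 limit. The increments of a Brownian motion are centred,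
    independent of the past and of variance equal to the elapsed time; this gives
    the isometry for simple integrands, then for Ito integrals (ito_isometry),
    and the orthogonality of later increments to the past (ito_martingale). An
    increment of [X] is the sum of a drift part, of the order of the elapsed time
    [h], and of a noise part, of order [h ^ (1/2)]; the second moments therefore
    move by [h] times the Lyapunov expression up to an error of order [h ^ (3/2)]
    (second_moment_incr), and such errors cannot accumulate
    (nonincreasing_of_small_increments).

    The matrix differential equation is treated in the same spirit: an Euler step
    preserves positivity up to an error of second order, which an exponential
    perturbation absorbs (lyapunov_ode_psd). *)

Set Implicit Arguments.
Unset Strict Implicit.
Unset Printing Implicit Defensive.

Import Order.TTheory GRing.Theory Num.Theory.
Import numFieldNormedType.Exports.

Local Open Scope classical_set_scope.
Local Open Scope ring_scope.

(** * Square integrable functions *)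

Section SquareIntegrable.
Context d (T : measurableType d) (K : realType).
Variable mu : {measure set T -> \bar K}.
Implicit Types (f g : T -> K) (c : K).

(** Plain functions rather than a bundled type: measurability of the processes below
    is a hypothesis that is available at nonnegative times only. *)
Definition sqint f := measurable_fun setT f /\
  mu.-integrable setT (fun x => (f x ^+ 2)%:E).

Definition L2ip f g : K := Rintegral mu setT (f \* g).

Definition L2nrm f : K := Num.sqrt (L2ip f f).

Lemma sqintP f : measurable_fun setT f ->
  (\int[mu]_x (f x ^+ 2)%:E < +oo)%E -> sqint f.
Proof.
move=> mf fi; split => //; apply/integrableP; split.
  by apply/measurable_EFinP; exact: measurable_funX.
by under eq_integral do rewrite /= ger0_norm ?sqr_ge0//.
Qed.

Lemma sqint_prod f g : sqint f -> sqint g ->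
  mu.-integrable setT (fun x => (f x * g x)%:E).
Proof.
move=> [mf fi] [mg gi].
apply: (@le_integrable _ _ _ _ _ measurableT _
  (fun x => (f x ^+ 2)%:E + (g x ^+ 2)%:E)%E).
- by apply/measurable_EFinP; exact: measurable_funM.
- move=> x _; rewrite /= lee_fin [leRHS]ger0_norm ?addr_ge0 ?sqr_ge0//.
  by rewrite ler_norml; apply/andP; split; nra.
- exact: integrableD.
Qed.

Lemma sqintD f g : sqint f -> sqint g -> sqint (f \+ g).
Proof.
move=> sf sg; have fg := sqint_prod sf sg.
have [[mf fi] [mg gi]] := (sf, sg); split; first exact: measurable_funD.
apply: (@eq_integrable _ _ _ _ _ measurableT
  (fun x => ((f x ^+ 2)%:E + (f x * g x)%:E + (f x * g x)%:E + (g x ^+ 2)%:E)%E)).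
  by move=> x _; rewrite -!EFinD; congr (_%:E) => /=; ring.
by do 3 (apply: integrableD => //).
Qed.

Lemma sqintZ c f : sqint f -> sqint (fun x => c * f x).
Proof.
move=> [mf fi]; split; first exact: measurable_funM.
apply: (@eq_integrable _ _ _ _ _ measurableT
  (fun x => ((c ^+ 2)%:E * (f x ^+ 2)%:E)%E)).
  by move=> x _; rewrite -!EFinM; congr (_%:E) => /=; ring.
exact: integrableZl.
Qed.

Lemma sqintB f g : sqint f -> sqint g -> sqint (f \- g).
Proof.
move=> sf sg; rewrite (_ : f \- g = f \+ (fun x => -1 * g x)).
  exact/sqintD/sqintZ.
by apply/funext => x /=; rewrite mulN1r.
Qed.

Lemma sqint0 : sqint (cst 0).
Proof.
split => //; rewrite (_ : (fun _ => _) = cst 0%E); first exact: integrable0.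
by apply/funext => x /=; rewrite expr0n.
Qed.

Lemma sqint_sum I (s : seq I) (h : I -> T -> K) : (forall i, sqint (h i)) ->
  sqint (fun x => \sum_(i <- s) h i x).
Proof.
move=> sh; elim: s => [|i s IH].
  by under eq_fun do rewrite big_nil; exact: sqint0.
by under eq_fun do rewrite big_cons; exact: sqintD.
Qed.

Lemma sqint_ae f g : measurable_fun setT f -> ae_eq mu setT f g -> sqint g ->
  sqint f.
Proof.
move=> mf fg [mg gi]; apply: sqintP => //.
rewrite (@ge0_ae_eq_integral _ _ _ mu _ _ (fun x => (g x ^+ 2)%:E))//.
- move/integrableP : gi => [_]; congr (_ < _)%E; apply: eq_integral => x _.
  by rewrite /= ger0_norm ?sqr_ge0.
- by apply/measurable_EFinP; exact: measurable_funX.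
- by apply/measurable_EFinP; exact: measurable_funX.
- by move=> x _; rewrite lee_fin sqr_ge0.
- by move=> x _; rewrite lee_fin sqr_ge0.
- by apply: filterS fg => x /= /[apply] ->.
Qed.

Lemma ip_ae f1 f2 g : ae_eq mu setT f1 f2 -> sqint f1 -> sqint f2 -> sqint g ->
  L2ip f1 g = L2ip f2 g.
Proof.
move=> f12 [mf1 _] [mf2 _] [mg _]; congr (fine _); apply: ae_eq_integral => //.
- by apply/measurable_EFinP; exact: measurable_funM.
- by apply/measurable_EFinP; exact: measurable_funM.
- by apply: filterS f12 => x /= /[apply] ->.
Qed.

Lemma ipC f g : L2ip f g = L2ip g f.
Proof. by congr Rintegral; apply/funext => x /=; rewrite mulrC. Qed.

Lemma ipDl f g h : sqint f -> sqint g -> sqint h ->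
  L2ip (f \+ g) h = L2ip f h + L2ip g h.
Proof.
move=> sf sg sh; rewrite /L2ip -RintegralD//; [|exact: sqint_prod..].
by congr Rintegral; apply/funext => x /=; rewrite mulrDl.
Qed.

Lemma ipZl c f g : sqint f -> sqint g -> L2ip (fun x => c * f x) g = c * L2ip f g.
Proof.
move=> sf sg; rewrite /L2ip -RintegralZl//; last exact: sqint_prod.
by congr Rintegral; apply/funext => x /=; rewrite mulrA.
Qed.

Lemma ipBl f g h : sqint f -> sqint g -> sqint h ->
  L2ip (f \- g) h = L2ip f h - L2ip g h.
Proof.
move=> sf sg sh; rewrite (_ : f \- g = f \+ (fun x => -1 * g x)); last first.
  by apply/funext => x /=; rewrite mulN1r.
by rewrite ipDl ?ipZl ?mulN1r//; exact: sqintZ.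
Qed.

Lemma ipDr f g h : sqint f -> sqint g -> sqint h ->
  L2ip h (f \+ g) = L2ip h f + L2ip h g.
Proof. by move=> *; rewrite ipC ipDl// !(ipC h). Qed.

Lemma ipZr c f g : sqint f -> sqint g -> L2ip g (fun x => c * f x) = c * L2ip g f.
Proof. by move=> *; rewrite ipC ipZl// ipC. Qed.

Lemma ipBr f g h : sqint f -> sqint g -> sqint h ->
  L2ip h (f \- g) = L2ip h f - L2ip h g.
Proof. by move=> *; rewrite ipC ipBl// !(ipC h). Qed.

Lemma ip0l g : L2ip (cst 0) g = 0.
Proof.
rewrite /L2ip /Rintegral; rewrite (_ : (fun _ => _) = cst 0%E) ?integral0//.
by apply/funext => x /=; rewrite mul0r.
Qed.

Lemma ip_suml I (s : seq I) (h : I -> T -> K) g :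
  (forall i, sqint (h i)) -> sqint g ->
  L2ip (fun x => \sum_(i <- s) h i x) g = \sum_(i <- s) L2ip (h i) g.
Proof.
move=> sh sg; elim: s => [|i s IH].
  by under eq_fun do rewrite big_nil; rewrite big_nil; exact: ip0l.
under eq_fun do rewrite big_cons; rewrite big_cons -IH.
by rewrite -ipDl//; exact: sqint_sum.
Qed.

Lemma ip_sumr I (s : seq I) (h : I -> T -> K) g :
  (forall i, sqint (h i)) -> sqint g ->
  L2ip g (fun x => \sum_(i <- s) h i x) = \sum_(i <- s) L2ip g (h i).
Proof. by move=> *; rewrite ipC ip_suml//; apply: eq_bigr => i _; exact: ipC. Qed.

Lemma ip_ge0 f : 0 <= L2ip f f.
Proof. by apply: Rintegral_ge0 => x _ /=; rewrite -expr2 sqr_ge0. Qed.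

Lemma nrm_ge0 f : 0 <= L2nrm f.
Proof. exact: sqrtr_ge0. Qed.

Lemma nrm2 f : L2nrm f ^+ 2 = L2ip f f.
Proof. by rewrite sqr_sqrtr// ip_ge0. Qed.

Lemma nrm2E f : sqint f -> (\int[mu]_x (f x ^+ 2)%:E = (L2nrm f ^+ 2)%:E)%E.
Proof.
move=> [mf fi]; rewrite nrm2 /L2ip /Rintegral fineK//=; last first.
  rewrite (_ : (fun _ => _) = (fun x => (f x ^+ 2)%:E)).
    exact: integrable_fin_num.
  by apply/funext => x; rewrite expr2.
Qed.

(** Membership in L2 is always obtained in this form: the bound on the extended
    integral gives integrability and the norm estimate at once. *)
Lemma nrm_leP f c : measurable_fun setT f -> 0 <= c ->
  (\int[mu]_x (f x ^+ 2)%:E <= (c ^+ 2)%:E)%E -> sqint f /\ L2nrm f <= c.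
Proof.
move=> mf c0 fc.
have sf : sqint f by apply: sqintP => //; apply: le_lt_trans fc _; rewrite ltry.
split=> //; move: fc; rewrite nrm2E// lee_fin.
by rewrite ler_pXn2r// nnegrE// nrm_ge0.
Qed.

(** Cauchy-Schwarz: the quadratic [c |-> L2ip (f + c g) (f + c g)] is
    nonnegative. If [L2ip g g] vanishes it is affine in [c], hence [L2ip f g = 0]. *)
Lemma ip_le_nrm f g : sqint f -> sqint g -> `|L2ip f g| <= L2nrm f * L2nrm g.
Proof.
move=> sf sg.
have key c : 0 <= L2ip f f + 2 * c * L2ip f g + c ^+ 2 * L2ip g g.
  have := ip_ge0 (f \+ (fun x => c * g x)).
  have sc := sqintZ c sg.
  rewrite ipDl ?ipDr ?ipZl ?ipZr//; try exact: sqintD.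
  by rewrite (ipC g f); congr (_ <= _); ring.
rewrite -(@ler_pXn2r _ 2)// ?nnegrE ?mulr_ge0 ?nrm_ge0//.
rewrite exprMn !nrm2 real_normK ?num_real//.
have [g0|g0] := eqVneq (L2ip g g) 0.
  have [->|fg0] := eqVneq (L2ip f g) 0; first by rewrite expr0n mulr_ge0 ?ip_ge0.
  have := key (- (L2ip f f + 1) / (2 * L2ip f g)).
  rewrite g0 mulr0 addr0 (_ : 2 * _ * _ = - (L2ip f f + 1)); last by field.
  by rewrite opprD addrA subrr sub0r oppr_ge0 ler10.
have gp : 0 < L2ip g g by rewrite lt0r g0 ip_ge0.
have := key (- L2ip f g / L2ip g g).
rewrite -(pmulr_lge0 _ gp) -subr_ge0.
rewrite [X in 0 <= X -> _](_ : _ = L2ip f f * L2ip g g - L2ip f g ^+ 2)//.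
by field.
Qed.

Lemma ip_le f g a b : sqint f -> sqint g -> L2nrm f <= a -> L2nrm g <= b ->
  `|L2ip f g| <= a * b.
Proof.
move=> sf sg fa gb; apply: le_trans (ip_le_nrm sf sg) _.
by apply: ler_pM; rewrite ?nrm_ge0.
Qed.

Lemma nrmD f g : sqint f -> sqint g -> L2nrm (f \+ g) <= L2nrm f + L2nrm g.
Proof.
move=> sf sg; rewrite -(@ler_pXn2r _ 2)// ?nnegrE ?addr_ge0 ?nrm_ge0//.
rewrite sqrrD !nrm2 ipDl ?ipDr//; try exact: sqintD.
rewrite (ipC g f); have := ip_le_nrm sf sg; rewrite ler_norml => /andP[_ h].
by rewrite -mulr_natl; lra.
Qed.

Lemma nrmZ c f : sqint f -> L2nrm (fun x => c * f x) = `|c| * L2nrm f.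
Proof.
move=> sf; rewrite /L2nrm ipZl ?ipZr//; last exact: sqintZ.
by rewrite mulrA -expr2 sqrtrM ?sqr_ge0// sqrtr_sqr.
Qed.

Lemma nrm0 : L2nrm (cst 0) = 0.
Proof. by rewrite /L2nrm ip0l sqrtr0. Qed.

Lemma nrm_sum I (s : seq I) (h : I -> T -> K) : (forall i, sqint (h i)) ->
  L2nrm (fun x => \sum_(i <- s) h i x) <= \sum_(i <- s) L2nrm (h i).
Proof.
move=> sh; elim: s => [|i s IH].
  by under eq_fun do rewrite big_nil; rewrite big_nil nrm0.
under eq_fun do rewrite big_cons; rewrite big_cons.
by apply: le_trans (nrmD _ _) _; rewrite ?lerD2l//; exact: sqint_sum.
Qed.

Definition L2cvg (f_ : nat -> T -> K) f :=
  [/\ forall k, sqint (f_ k), sqint f & (fun k => L2nrm (f_ k \- f)) @ \oo --> 0].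

(** Convergence of the extended integrals to zero already forces the limit to be
    square integrable, since it differs from some term by an L2 function. *)
Lemma L2cvgP (f_ : nat -> T -> K) f :
  (forall k, sqint (f_ k)) -> measurable_fun setT f ->
  (fun k => \int[mu]_x ((f_ k x - f x) ^+ 2)%:E)%E @ \oo --> 0%E ->
  L2cvg f_ f.
Proof.
move=> sf mf cf.
have sB k : (\int[mu]_x ((f_ k x - f x) ^+ 2)%:E < +oo)%E -> sqint (f_ k \- f).
  by apply: sqintP; apply: measurable_funB => //; exact: (sf k).1.
case/fine_cvgP: cf => cfin cf.
have [k0 sk0] : exists k, (\int[mu]_x ((f_ k x - f x) ^+ 2)%:E < +oo)%E.
  case: cfin => k _ /(_ k (leqnn k)) fk; exists k.
  by rewrite -ge0_fin_numE// integral_ge0// => x _; rewrite lee_fin sqr_ge0.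
have sff : sqint f.
  rewrite (_ : f = f_ k0 \- (f_ k0 \- f)); first exact/sqintB/sB.
  by apply/funext => x /=; rewrite subKr.
split => //; apply/cvgrPdist_lt => e e0.
move/cvgrPdist_lt : cf => /(_ _ (exprn_gt0 2 e0)); apply: filterS => k /=.
rewrite (nrm2E (sqintB (sf k) sff))/= !sub0r !normrN !ger0_norm ?nrm_ge0 ?sqr_ge0//.
by rewrite ltr_pXn2r ?nnegrE ?nrm_ge0 ?ltW.
Qed.

Lemma L2cvg_ip (f_ g_ : nat -> T -> K) f g : L2cvg f_ f -> L2cvg g_ g ->
  (fun k => L2ip (f_ k) (g_ k)) @ \oo --> L2ip f g.
Proof.
move=> [sf_ sf cf] [sg_ sg cg].
have key k : `|L2ip f g - L2ip (f_ k) (g_ k)| <=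
    L2nrm (f_ k \- f) * L2nrm (g_ k \- g) + L2nrm (f_ k \- f) * L2nrm g
      + L2nrm f * L2nrm (g_ k \- g).
  have sfk := sqintB (sf_ k) sf; have sgk := sqintB (sg_ k) sg.
  rewrite distrC (_ : L2ip _ _ - _ = L2ip (f_ k \- f) (g_ k \- g)
    + L2ip (f_ k \- f) g + L2ip f (g_ k \- g)).
    rewrite (le_trans (ler_normD _ _))// lerD ?ip_le_nrm//.
    by rewrite (le_trans (ler_normD _ _))// lerD ?ip_le_nrm.
  by rewrite !ipBl// !ipBr//; ring.
have : (fun k => L2nrm (f_ k \- f) * L2nrm (g_ k \- g) + L2nrm (f_ k \- f) * L2nrm g
      + L2nrm f * L2nrm (g_ k \- g)) @ \oo --> (0 : K).
  rewrite [X in _ --> X](_ : 0 = 0 * 0 + 0 * L2nrm g + L2nrm f * 0); last by ring.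
  apply: cvgD; last by apply: cvgM => //; exact: cvg_cst.
  by apply: cvgD; apply: cvgM => //; exact: cvg_cst.
move=> /cvgrPdist_le h; apply/cvgrPdist_le => e /h; apply: filterS => k.
by rewrite sub0r normrN => /(le_trans (ler_norm _)); exact: le_trans.
Qed.

End SquareIntegrable.

(** * Moments of the centred normal law *)

Section NormalMoments.
Context {K : realType}.
Notation mu := (@lebesgue_measure K).
Variable s : K.
Hypothesis s0 : 0 < s.
Let pdf : K -> K := normal_pdf 0 s.

Let scaleRE (a b : K) : a *: b = a * b. Proof. by []. Qed.

Let sN0 : s != 0. Proof. by rewrite gt_eqF. Qed.

Let pdfE x : pdf x = normal_peak s * expR (- (x ^+ 2) / (s ^+ 2 *+ 2)).
Proof. by rewrite /pdf normal_pdfE// /normal_fun subr0. Qed.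

Let measurable_pdf : measurable_fun setT pdf.
Proof. exact: measurable_normal_pdf. Qed.

Let pdf_ge0 x : 0 <= pdf x. Proof. exact: normal_pdf_ge0. Qed.

Let pdfN x : pdf (- x) = pdf x.
Proof. by rewrite !pdfE sqrrN. Qed.

Let continuous_pdf : continuous pdf.
Proof. exact: continuous_normal_pdf. Qed.

Let is_derive_pdf (x : K) : is_derive x (1 : K) pdf (- (x / s ^+ 2) * pdf x).
Proof.
rewrite (_ : pdf = fun x => normal_peak s * expR (- (x ^+ 2) / (s ^+ 2 *+ 2)));
  last exact/funext/pdfE.
pose q (x : K) : K := - x ^+ 2 / (s ^+ 2 *+ 2).
have dq : is_derive x (1 : K) q (- (x / s ^+ 2)).
  rewrite (_ : q = (- (s ^+ 2 *+ 2)^-1) \*: (id ^+ 2)); last first.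
    apply/funext => y; rewrite /q exprfctE.
    by rewrite [RHS](_ : _ = - (s ^+ 2 *+ 2)^-1 * y ^+ 2)//; ring.
  by apply: is_derive_eq; rewrite !scaleRE/= -mulr_natr; field.
apply: (@is_derive_eq _ _ _ (normal_peak s \*: (expR \o q))).
by rewrite !scaleRE/= /q; ring.
Qed.

(** The normal law is defined by its density, so its Radon-Nikodym derivative is
    that density almost everywhere. *)
Lemma ge0_integral_normal (f : K -> \bar K) : (forall x, 0 <= f x)%E ->
  measurable_fun setT f ->
  (\int[normal_prob 0 s]_x f x = \int[mu]_x (f x * (pdf x)%:E))%E.
Proof.
move=> f0 mf.
have dom := @normal_prob_dominates K 0 s.
rewrite -(Radon_Nikodym_SigmaFinite.change_of_variables dom)//.
apply: ae_eq_integral => //.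
- apply: emeasurable_funM => //.
  exact: measurable_int (Radon_Nikodym_SigmaFinite.f_integrable _).
- by apply: emeasurable_funM => //; exact/measurable_EFinP.
- apply: ae_eqe_mul2l => /=.
  apply: integral_ae_eq => //.
  + exact: Radon_Nikodym_SigmaFinite.f_integrable.
  + exact/measurable_EFinP.
  + by move=> E _ mE; rewrite -Radon_Nikodym_SigmaFinite.f_integral.
Qed.

Let integral_pdf_sym (f : K -> K) : (forall x, 0 <= f x) -> continuous f ->
  (forall x, f (- x) = f x) ->
  (\int[mu]_x (f x * pdf x)%:E = 2%:E * \int[mu]_(x in `[0%R, +oo[) (f x * pdf x)%:E)%E.
Proof.
move=> f0 cf fN; rewrite set_itvcy; apply: (ge0_symfun_integralT (f := fun x => f x * pdf x)).
- by move=> x; rewrite mulr_ge0.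
- by move=> x; apply: cvgM; [exact: cf|exact: continuous_pdf].
- by move=> x /=; rewrite fN pdfN.
Qed.

(** [F' = (x^2 - s^2) pdf], so that [F] compares the second moment with the mass. *)
Let F x : K := - (x * s ^+ 2 * pdf x).

Let is_derive_F x : is_derive x (1 : K) F ((x ^+ 2 - s ^+ 2) * pdf x).
Proof.
have := is_derive_pdf x => ?.
rewrite (_ : F = (- s ^+ 2) \*: (id * pdf)); last first.
  apply/funext => y; rewrite /F.
  by rewrite [RHS](_ : _ = - s ^+ 2 * (y * pdf y))//; ring.
by apply: is_derive_eq; rewrite !scaleRE/=; field.
Qed.

Let F_cvg : F x @[x --> +oo] --> 0.
Proof.
have c0 : 0 < s ^+ 2 *+ 2 by rewrite pmulrn_lgt0// exprn_gt0.
have Fle (x : K) : 0 < x -> `|F x| <= s ^+ 2 * normal_peak s * (s ^+ 2 *+ 2) * x^-1.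
  move=> x0; rewrite /F normrN ger0_norm; last by rewrite !mulr_ge0 ?pdf_ge0 ?sqr_ge0 ?(ltW x0) ?(ltW s0).
  rewrite pdfE mulNr expRN mulrA.
  have y0 : 0 < x ^+ 2 / (s ^+ 2 *+ 2) by rewrite divr_gt0// exprn_gt0.
  have : (expR (x ^+ 2 / (s ^+ 2 *+ 2)))^-1 <= (x ^+ 2 / (s ^+ 2 *+ 2))^-1.
    rewrite lef_pV2 ?posrE ?expR_gt0//.
    by apply: le_trans (expR_ge1Dx _); rewrite lerDr.
  have p0 : 0 <= x * s ^+ 2 * normal_peak s.
    by rewrite !mulr_ge0 ?sqr_ge0 ?normal_peak_ge0 ?(ltW x0) ?(ltW s0).
  move=> /(ler_wpM2l p0) /le_trans; apply.
  rewrite le_eqVlt; apply/orP; left; apply/eqP; field.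
  by rewrite (gt_eqF x0) sN0.
apply/cvgr0Pnorm_le => e e0; near=> x.
apply: le_trans (Fle _ _) _ => //.
rewrite ler_pdivrMr// -ler_pdivrMl//.
Unshelve. all: by end_near. Qed.

Let continuous_F : continuous F.
Proof.
move=> x; apply: cvgN; apply: cvgM; last exact: continuous_pdf.
by apply: cvgM => //; exact: cvg_cst.
Qed.

Let integral_tail :
  (\int[mu]_(x in `[s, +oo[) ((x ^+ 2 - s ^+ 2) * pdf x)%:E = (- F s)%:E)%E.
Proof.
rewrite (@ge0_continuous_FTC2y _ _ F s 0) ?add0e ?EFinN//.
- move=> x sx; rewrite mulr_ge0// subr_ge0 ler_pXn2r// nnegrE ltW//.
  exact: lt_le_trans sx.
- apply: continuous_subspaceT => x.
  apply: cvgM; last exact: continuous_pdf.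
  by apply: cvgB; [exact: exprn_continuous|exact: cvg_cst].
- by move=> x _; have [] := is_derive_F x.
- exact/cvg_at_right_filter/continuous_F.
- by move=> x _; rewrite derive1E; case: (is_derive_F x).
Qed.

Let integral_head :
  (\int[mu]_(x in `[0%R, s]) ((s ^+ 2 - x ^+ 2) * pdf x)%:E = (- F s)%:E)%E.
Proof.
rewrite (@continuous_FTC2 _ _ (fun x => - F x) 0 s)//.
- by rewrite /F mul0r mul0r oppr0 oppr0 sube0.
- apply: continuous_subspaceT => x.
  apply: cvgM; last exact: continuous_pdf.
  by apply: cvgB; [exact: cvg_cst|exact: exprn_continuous].
- split.
  + by move=> x _; apply: derivableN; have [] := is_derive_F x.
  + apply: cvgN; exact/cvg_at_right_filter/continuous_F.
  + apply: cvgN; exact/cvg_at_left_filter/continuous_F.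
- move=> x _; rewrite derive1E deriveN ; last by have [] := is_derive_F x.
  by have [_ ->] := is_derive_F x; rewrite -mulNr opprB.
Qed.

(** The fundamental theorem of calculus for [F] on both sides of [s], where its
    derivative changes sign: the two boundary terms [F s] cancel. *)
Let integral_pos :
  (\int[mu]_(x in `[0%R, +oo[) (x ^+ 2 * pdf x)%:E =
   (s ^+ 2)%:E * \int[mu]_(x in `[0%R, +oo[) (pdf x)%:E)%E.
Proof.
have mpol : measurable_fun setT (fun x : K => x ^+ 2 * pdf x).
  exact: measurable_funM.
have split_int (f : K -> K) : (forall x, 0 <= f x) -> measurable_fun setT f ->
    (\int[mu]_(x in `[0%R, +oo[) (f x)%:E = \int[mu]_(x in `[0%R, s[) (f x)%:E +
     \int[mu]_(x in `[s, +oo[) (f x)%:E)%E.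
  move=> f0 mf; rewrite -ge0_integral_setU//=.
  - by rewrite -itv_bndbnd_setU//= bnd_simp ltW.
  - by apply/measurable_EFinP; exact: measurable_funTS.
  - by move=> x _; rewrite lee_fin.
  - by apply: lt_disjoint => x y; rewrite !in_itv/= => /andP[_ +] /andP[+ _];
      exact: lt_le_trans.
rewrite (split_int pdf)// (split_int (fun x => x ^+ 2 * pdf x))//; last first.
  by move=> x; rewrite mulr_ge0 ?sqr_ge0.
rewrite ge0_muleDr ?integral_ge0//; [|by move=> x _; rewrite lee_fin..].
have -> : ((s ^+ 2)%:E * \int[mu]_(x in `[0%R, s[) (pdf x)%:E =
    \int[mu]_(x in `[0%R, s[) (x ^+ 2 * pdf x)%:E + (- F s)%:E)%E.
  rewrite -integral_head -integral_itv_bndo_bndc; last first.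
    apply/measurable_EFinP; apply: measurable_funM; apply: measurable_funTS => //.
    exact: measurable_funB.
  rewrite -ge0_integralZl//; last 3 first.
  - by apply/measurable_EFinP; exact: measurable_funTS.
  - by move=> x _; rewrite lee_fin.
  - by rewrite lee_fin sqr_ge0.
  rewrite -ge0_integralD//.
  - by apply: eq_integral => x _; rewrite -EFinM -EFinD; congr EFin; ring.
  - by move=> x _; rewrite lee_fin mulr_ge0 ?sqr_ge0.
  - by apply/measurable_EFinP; exact: measurable_funTS.
  - move=> x; rewrite /= in_itv/= => /andP[x0 xs]; rewrite lee_fin mulr_ge0//.
    by rewrite subr_ge0 ler_pXn2r ?nnegrE// ltW.
  - apply/measurable_EFinP; apply: measurable_funM; apply: measurable_funTS => //.
    exact: measurable_funB.
suff -> : (\int[mu]_(x in `[s, +oo[) (x ^+ 2 * pdf x)%:E = (- F s)%:E +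
    (s ^+ 2)%:E * \int[mu]_(x in `[s, +oo[) (pdf x)%:E)%E by rewrite addeA.
rewrite -integral_tail -ge0_integralZl//; last 3 first.
- by apply/measurable_EFinP; exact: measurable_funTS.
- by move=> x _; rewrite lee_fin.
- by rewrite lee_fin sqr_ge0.
rewrite -ge0_integralD//.
- by apply: eq_integral => x _; rewrite -EFinM -EFinD; congr EFin; ring.
- move=> x; rewrite /= in_itv/= => /andP[sx _]; rewrite lee_fin mulr_ge0//.
  by rewrite subr_ge0 ler_pXn2r ?nnegrE// ?(ltW s0) ?(le_trans (ltW s0)).
- apply/measurable_EFinP; apply: measurable_funM; apply: measurable_funTS => //.
  exact: measurable_funB.
- by move=> x _; rewrite mule_ge0// lee_fin ?sqr_ge0.
- apply/measurable_EFinP; apply: measurable_funM; apply: measurable_funTS => //.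
Qed.

Lemma normal_prob_second_moment :
  (\int[normal_prob 0 s]_x (x ^+ 2)%:E = (s ^+ 2)%:E)%E.
Proof.
rewrite ge0_integral_normal//; last 2 first.
- by move=> x; rewrite lee_fin sqr_ge0.
- by apply/measurable_EFinP.
have := integral_pdf_sym (f := cst 1) => /(_ (fun _ => ler01)).
move=> /(_ (fun=> cvg_cst _) (fun=> erefl)).
under eq_integral do rewrite mul1r.
rewrite integral_normal_pdf.
under eq_integral do rewrite mul1r.
move=> one.
rewrite -[RHS]mule1 [in RHS]one muleCA -integral_pos.
rewrite -(integral_pdf_sym (f := fun x => x ^+ 2))//.
- by move=> x; rewrite sqr_ge0.
- exact: exprn_continuous.
- by move=> x; rewrite sqrrN.
Qed.

(** The centred normal law is symmetric; its first moment vanishes by this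
    symmetry. *)
Lemma normal_probN (A : set K) : measurable A ->
  pushforward (normal_prob 0 s) (-%R : _ -> measurableTypeR K) A =
  normal_prob 0 s A.
Proof.
move=> mA; rewrite /pushforward /normal_prob.
transitivity (\int[mu]_(x in (-%R : _ -> measurableTypeR K) @^-1` A)
    ((EFin \o pdf) \o (-%R : _ -> measurableTypeR K)) x)%E.
  by apply: eq_integral => x _ /=; rewrite pdfN.
rewrite -ge0_integral_pushforward//=; last 2 first.
- by apply/measurable_EFinP; exact: measurable_funTS.
- by move=> x _; rewrite lee_fin.
by apply: eq_measure_integral => //= B mB _; exact: lebesgue_measureN.
Qed.

Lemma integrable_normal_id :
  (normal_prob 0 s).-integrable setT (fun x : measurableTypeR K => (x : K)%:E).
Proof.
apply: (@le_integrable _ _ _ _ _ measurableT _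
    (fun x : measurableTypeR K => 1%:E + ((x : K) ^+ 2)%:E)%E) => //.
- exact: EFin_measurable.
- by move=> x _; rewrite lee_fin [leRHS]ger0_norm ?addr_ge0 ?sqr_ge0// ler_norml; nra.
- apply: integrableD => //; first exact: finite_measure_integrable_cst.
  apply/integrableP; split; first exact/measurable_EFinP.
  under eq_integral do rewrite /= ger0_norm ?sqr_ge0//.
  by rewrite normal_prob_second_moment ltry.
Qed.

Lemma normal_prob_first_moment : (\int[normal_prob 0 s]_x x%:E = 0)%E.
Proof.
set I := (X in X = _).
have IN : I = (- I)%E.
  transitivity (\int[pushforward (normal_prob 0 s)
                  (-%R : _ -> measurableTypeR K)]_x x%:E)%E.
    by apply: eq_measure_integral => A mA _; apply/esym; exact: normal_probN.
  rewrite integral_pushforward//= preimage_setT.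
    under eq_integral do rewrite EFinN.
    rewrite integralN//; apply: integrable_add_def => //.
    exact: integrable_normal_id.
  exact: (integrableN integrable_normal_id).
have : I \is a fin_num.
  exact: (integrable_fin_num measurableT integrable_normal_id).
case: I IN => [r| |]// [rr] _; congr EFin; lra.
Qed.

End NormalMoments.

(** * Products and independence *)

Section ProductIntegral.
Context d1 d2 (T1 : measurableType d1) (T2 : measurableType d2) (K : realType).
Variable m1 : {sigma_finite_measure set T1 -> \bar K}.
Variable m2 : {sigma_finite_measure set T2 -> \bar K}.
Variables (u : T1 -> K) (v : T2 -> K).
Hypothesis ui : m1.-integrable setT (EFin \o u).
Hypothesis vi : m2.-integrable setT (EFin \o v).

Lemma integrable_prod :
  (m1 \x m2)%E.-integrable setT (fun p => (u p.1 * v p.2)%:E).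
Proof.
have mu : measurable_fun setT u by apply/measurable_EFinP; exact: measurable_int ui.
have mv : measurable_fun setT v by apply/measurable_EFinP; exact: measurable_int vi.
have muv : measurable_fun setT (fun p : T1 * T2 => (u p.1 * v p.2)%:E).
  by apply/measurable_EFinP; apply: measurable_funM; exact: measurableT_comp.
apply/integrable12ltyP => //=.
rewrite (_ : (\int[m1]_x _)%E =
    (\int[m1]_x `|(u x)%:E| * \int[m2]_y `|(v y)%:E|)%E).
  case/integrableP : ui => _ /= ui'; case/integrableP : vi => _ /= vi'.
  by rewrite lte_mul_pinfty// ?integral_ge0// ge0_fin_numE ?integral_ge0.
rewrite -ge0_integralZr//=; last first.
- exact: integral_ge0.
- by do 2 apply: measurableT_comp.
apply: eq_integral => x _; rewrite -ge0_integralZl//=.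
  by apply: eq_integral => y _; rewrite normrM.
by do 2 apply: measurableT_comp.
Qed.

Lemma Rintegral_prod :
  Rintegral (m1 \x m2)%E setT (fun p => u p.1 * v p.2) =
  Rintegral m1 setT u * Rintegral m2 setT v.
Proof.
rewrite /Rintegral -integral12_prod_meas1; last exact: integrable_prod.
rewrite -fineM; [|exact: integrable_fin_num..].
congr fine; have vf := integrable_fin_num measurableT vi.
rewrite -(fineK vf) -integralZr//.
apply: eq_integral => x _; rewrite fineK// /fubini_F /=.
by rewrite -integralZl.
Qed.

End ProductIntegral.

Section Independence.
Context d (Omega : measurableType d) (K : realType) (P : probability Omega K).
Variables X Y : Omega -> K.
Hypothesis mX : measurable_fun setT X.
Hypothesis mY : measurable_fun setT Y.
Hypothesis XY : forall A B : set K, measurable A -> measurable B ->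
  P (X @^-1` A `&` Y @^-1` B) = (P (X @^-1` A) * P (Y @^-1` B))%E.
Hypothesis iX : P.-integrable setT (EFin \o X).
Hypothesis iY : P.-integrable setT (EFin \o Y).

Let X' : {mfun Omega >-> K} := mfun_Sub (mem_set mX).
Let Y' : {mfun Omega >-> K} := mfun_Sub (mem_set mY).
Let mZ : measurable_fun setT (fun w => (X w, Y w)).
Proof. exact: measurable_fun_pair. Qed.
Let Z' : {mfun Omega >-> (K * K)%type} :=
  mfun_Sub (mem_set mZ).

(** Independence says that the joint law is the product of the laws, and a product
    measure is determined by the measures of rectangles. *)
Let law A : measurable A -> (distribution P X' \x distribution P Y')%E A =
  distribution P Z' A.
Proof. by move=> mA; apply: product_measure_unique. Qed.

Let int_id (V : {mfun Omega >-> K}) :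
  P.-integrable setT (EFin \o V) ->
  (distribution P V).-integrable setT (EFin \o (id : K -> K)).
Proof.
move=> iV; apply/integrableP; split; first exact: EFin_measurable.
rewrite ge0_integral_distribution//=; last first.
  exact: measurableT_comp.
by case/integrableP : iV.
Qed.

Lemma integrable_indep : P.-integrable setT (fun w => (X w * Y w)%:E).
Proof.
have /integrableP[mm lt] := integrable_prod (int_id (V := X') iX) (int_id (V := Y') iY).
apply/integrableP; split.
  by apply/measurable_EFinP; exact: measurable_funM.
apply: le_lt_trans lt.
rewrite (eq_measure_integral (distribution P Z')); last by move=> A mA _; exact: law.
rewrite ge0_integral_distribution//=.
by do 2 apply: measurableT_comp => //; exact: measurable_funM.
Qed.

(** Transported to the joint law, which is a product, the expectation of a product
    factors by Fubini. *)
Lemma Rintegral_indep :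
  Rintegral P setT (fun w => X w * Y w) = Rintegral P setT X * Rintegral P setT Y.
Proof.
have tr (V : {mfun Omega >-> K}) : P.-integrable setT (EFin \o V) ->
    Rintegral P setT V = Rintegral (distribution P V) setT id.
  move=> iV; congr fine; rewrite integral_distribution//; exact: EFin_measurable.
rewrite (tr X')// (tr Y')// -Rintegral_prod; [|exact: int_id..].
congr fine; rewrite [RHS](eq_measure_integral (distribution P Z')); last first.
  by move=> A mA _; exact: law.
rewrite integral_distribution//; last exact: integrable_indep.
by apply/measurable_EFinP; exact: measurable_funM.
Qed.

End Independence.

(** * Brownian increments *)

Section Filtration.
Context (K : realType) d (Omega : measurableType d).
Variables (P : probability Omega K) (F : K -> set (set Omega)).
Hypothesis hF : filtration P F.
Implicit Types (t : K) (Z : Omega -> K).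

(** Each member of a filtration is a sigma-algebra, so it equals the one that it
    generates and the general theory of measurable functions applies to it. *)
Lemma measurable_atP t Z : 0 <= t ->
  measurable_at F t Z <->
  measurable_fun setT (Z : g_sigma_algebraType (F t) -> K).
Proof.
move=> t0; have [sF _ _ _] := hF; split => [mZ _ B mB|mZ B mB].
  by rewrite setTI; apply: sub_sigma_algebra; exact: mZ.
have := mZ measurableT B mB; rewrite setTI.
by rewrite /measurable/= (sigma_algebra_id (sF _ t0)).
Qed.

Lemma measurable_at_le s t Z : 0 <= s -> s <= t -> measurable_at F s Z ->
  measurable_at F t Z.
Proof. by move=> s0 st mZ B mB; have [_ _ + _] := hF; apply; [| exact: st | exact: mZ]. Qed.

Lemma measurable_at_measurable t Z : 0 <= t -> measurable_at F t Z ->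
  measurable_fun setT Z.
Proof.
move=> t0 mZ _ B mB; rewrite setTI; have [_ + _ _] := hF; apply; first exact: t0.
exact: mZ.
Qed.

Lemma measurable_atM t Z1 Z2 : 0 <= t -> measurable_at F t Z1 ->
  measurable_at F t Z2 -> measurable_at F t (fun w => Z1 w * Z2 w).
Proof.
move=> t0 /(measurable_atP _ t0) m1 /(measurable_atP _ t0) m2.
by apply/measurable_atP => //; exact: measurable_funM.
Qed.

Lemma measurable_atB t Z1 Z2 : 0 <= t -> measurable_at F t Z1 ->
  measurable_at F t Z2 -> measurable_at F t (fun w => Z1 w - Z2 w).
Proof.
move=> t0 /(measurable_atP _ t0) m1 /(measurable_atP _ t0) m2.
by apply/measurable_atP => //; exact: measurable_funB.
Qed.

End Filtration.

Section Bounded.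
Context d (T : measurableType d) (K : realType).
Variable mu : {measure set T -> \bar K}.

Lemma bounded_sqintM (f g : T -> K) : measurable_fun setT f ->
  (exists M : K, forall w, `|f w| <= M) ->
  sqint mu g -> sqint mu (fun w => f w * g w).
Proof.
move=> mf [M fM] [mg ig]; split; first exact: measurable_funM.
apply: (@le_integrable _ _ _ _ _ measurableT _
  (fun x => (M ^+ 2)%:E * (g x ^+ 2)%:E)%E).
- by apply/measurable_EFinP; apply: measurable_funX; exact: measurable_funM.
- move=> x _; rewrite /= lee_fin ger0_norm ?sqr_ge0// -exprMn.
  rewrite [leRHS]ger0_norm ?sqr_ge0// !exprMn.
  apply: ler_wpM2r; first exact: sqr_ge0.
  by rewrite -[leLHS]real_normK ?num_real// lerXn2r ?nnegrE// (le_trans _ (fM x)).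
- exact: integrableZl.
Qed.

End Bounded.

Section BrownianIncrements.
Context (K : realType) d (Omega : measurableType d).
Variables (P : probability Omega K) (F : K -> set (set Omega)).
Variable W : K -> Omega -> K.
Hypothesis hF : filtration P F.
Hypothesis hW : brownian_motion P F W.
Implicit Types (a b : K) (G : Omega -> K).

Definition incr a b w : K := W b w - W a w.

Lemma measurable_at_incr a b t : 0 <= a -> a <= b -> b <= t ->
  measurable_at F t (incr a b).
Proof.
move=> a0 ab bt; have [aW _ _ _ _] := hW; have b0 := le_trans a0 ab.
apply: (measurable_atB hF); first exact: le_trans bt.
  by apply: (measurable_at_le hF b0) => //; exact: aW.
by apply: (measurable_at_le hF a0); [exact: le_trans bt|exact: aW].
Qed.

Lemma measurable_incr a b : 0 <= a -> a <= b -> measurable_fun setT (incr a b).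
Proof.
move=> a0 ab; apply: (measurable_at_measurable hF (le_trans a0 ab)).
exact: measurable_at_incr.
Qed.

Let law a b (f : K -> \bar K) : 0 <= a -> a < b -> measurable_fun setT f ->
  (forall x, 0 <= f x)%E ->
  (\int[P]_w f (incr a b w) =
   \int[normal_prob 0 (Num.sqrt (b - a))]_x f x)%E.
Proof.
move=> a0 ab mf f0; have mi := measurable_incr a0 (ltW ab).
have [_ _ _ hlaw _] := hW.
pose I := @mfun_Sub _ _ Omega (measurableTypeR K) _ (mem_set mi).
rewrite -(ge0_integral_distribution I)//.
rewrite (eq_measure_integral (normal_prob 0 (Num.sqrt (b - a))))//.
by move=> A mA _; exact: hlaw.
Qed.

Lemma incr_moment2 a b : 0 <= a -> a <= b ->
  (\int[P]_w (incr a b w ^+ 2)%:E = (b - a)%:E)%E.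
Proof.
move=> a0; rewrite le_eqVlt => /predU1P[<-|ab].
  rewrite subrr; under eq_integral do rewrite /incr subrr expr0n/=.
  exact: integral0.
rewrite (law (f := fun x => (x ^+ 2)%:E))//.
- rewrite normal_prob_second_moment ?sqrtr_gt0 ?subr_gt0//.
  by rewrite sqr_sqrtr// subr_ge0 ltW.
- by apply/measurable_EFinP; exact: exprn_measurable.
- by move=> x; rewrite lee_fin sqr_ge0.
Qed.

Lemma sqint_incr a b : 0 <= a -> a <= b -> sqint P (incr a b).
Proof.
move=> a0 ab; apply: sqintP; first exact: measurable_incr.
by rewrite incr_moment2// ltry.
Qed.

Lemma integrable_sqint (f : Omega -> K) : sqint P f -> P.-integrable setT (EFin \o f).
Proof.
move=> sf; have s1 : sqint P (cst 1).
  split => //; under eq_fun do rewrite /= expr1n.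
  exact: finite_measure_integrable_cst.
rewrite (_ : EFin \o f = fun w => (f w * cst 1 w)%:E); first exact: sqint_prod.
by apply/funext => w; rewrite /= mulr1.
Qed.

Lemma incr_moment1 a b : 0 <= a -> a <= b -> Rintegral P setT (incr a b) = 0.
Proof.
move=> a0; rewrite le_eqVlt => /predU1P[<-|ab].
  rewrite (_ : incr a a = cst 0) ?/Rintegral ?integral0//.
  by apply/funext => w; rewrite /incr subrr.
have mi := measurable_incr a0 (ltW ab).
have [_ _ _ hlaw _] := hW.
pose I := @mfun_Sub _ _ Omega (measurableTypeR K) _ (mem_set mi).
have mE : measurable_fun setT (fun x : measurableTypeR K => (x : K)%:E).
  exact: EFin_measurable.
have iI := integrable_sqint (sqint_incr a0 (ltW ab)).
rewrite /Rintegral -[X in fine X](integral_distribution (X := I) mE iI).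
rewrite (eq_measure_integral (normal_prob 0 (Num.sqrt (b - a)))); last first.
  by move=> A mA _; exact: hlaw.
by rewrite normal_prob_first_moment// sqrtr_gt0 subr_gt0.
Qed.

Let incr_indep a b G : 0 <= a -> a < b -> measurable_at F a G ->
  forall A B : set K, measurable A -> measurable B ->
  P (G @^-1` A `&` incr a b @^-1` B) =
    (P (G @^-1` A) * P (incr a b @^-1` B))%E.
Proof.
move=> a0 ab mG A B mA mB; have [_ _ _ _] := hW; apply => //.
exact: mG.
Qed.

(** The increment is centred and independent of the past. *)
Lemma incr_orth a b G : 0 <= a -> a <= b -> measurable_at F a G ->
  P.-integrable setT (EFin \o G) ->
  P.-integrable setT (fun w => (G w * incr a b w)%:E) /\
  Rintegral P setT (fun w => G w * incr a b w) = 0.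
Proof.
move=> a0 ab mG iG; have mG' := measurable_at_measurable hF a0 mG.
have im := incr_moment1 a0 ab.
have ii := integrable_sqint (sqint_incr a0 ab).
move: ab; rewrite le_eqVlt => /predU1P[ab|ab].
  have E : (fun w => (G w * incr a b w)%:E) = cst 0%E.
    by apply/funext => w; rewrite -ab /incr subrr mulr0.
  by rewrite /Rintegral E integral0; split => //; exact: integrable0.
have mi := measurable_incr a0 (ltW ab).
have ind := incr_indep a0 ab mG.
split; first exact: integrable_indep.
by rewrite Rintegral_indep// im mulr0.
Qed.

(** The squared increment is independent of the past and has mean [b - a]. *)
Lemma incr_sqr a b G : 0 <= a -> a <= b -> measurable_at F a G ->
  P.-integrable setT (EFin \o G) ->
  P.-integrable setT (fun w => (G w * incr a b w ^+ 2)%:E) /\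
  Rintegral P setT (fun w => G w * incr a b w ^+ 2) =
    Rintegral P setT G * (b - a).
Proof.
move=> a0 ab mG iG; have mG' := measurable_at_measurable hF a0 mG.
have im : Rintegral P setT (fun w => incr a b w ^+ 2) = b - a.
  by rewrite /Rintegral incr_moment2.
have [_ ii] := sqint_incr a0 ab.
move: ab; rewrite le_eqVlt => /predU1P[ab|ab].
  have E : (fun w => (G w * incr a b w ^+ 2)%:E) = cst 0%E.
    by apply/funext => w; rewrite -ab /incr subrr expr0n mulr0.
  rewrite /Rintegral E integral0 -ab subrr mulr0.
  by split => //; exact: integrable0.
have mi := measurable_incr a0 (ltW ab).
have mi2 : measurable_fun setT (fun w => incr a b w ^+ 2) by exact: measurable_funX.
have ind (A B : set K) : measurable A -> measurable B ->
  P (G @^-1` A `&` (fun w => incr a b w ^+ 2) @^-1` B) =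
    (P (G @^-1` A) * P ((fun w => (incr a b w ^+ 2)%R) @^-1` B))%E.
  move=> mA mB; apply: (incr_indep a0 ab mG mA (B := (fun x => x ^+ 2) @^-1` B)).
  rewrite -[X in measurable X]setTI; apply: exprn_measurable => //.
split; first exact: (integrable_indep mG' mi2).
by rewrite (Rintegral_indep mG' mi2)// im.
Qed.

(** The length of the intersection of the intervals from [a] to [b] and from
    [a'] to [b']. *)
Definition overlap a b a' b' : K := Num.max 0 (Num.min b b' - Num.max a a').

Definition bounded (f : Omega -> K) := exists M : K, forall w, `|f w| <= M.

Lemma sqint_bounded f : measurable_fun setT f -> bounded f -> sqint P f.
Proof.
move=> mf bf; have s1 : sqint P (cst 1).
  split => //; under eq_fun do rewrite /= expr1n.
  exact: finite_measure_integrable_cst.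
rewrite (_ : f = fun w => f w * cst 1 w); first exact: bounded_sqintM.
by apply/funext => w; rewrite /= mulr1.
Qed.

Lemma ip_incr_degenerate x a g : L2ip P (fun w => x w * incr a a w) g = 0.
Proof.
rewrite (_ : (fun w => _) = cst 0) ?ip0l//.
by apply/funext => w; rewrite /incr subrr mulr0.
Qed.

Section Terms.
Variables (x y : Omega -> K) (a b a' b' : K).
Hypotheses (a0 : 0 <= a) (ab : a < b) (ab' : a' < b') (aa' : a <= a').
Hypotheses (mx : measurable_at F a x) (my : measurable_at F a' y).
Hypotheses (bx : bounded x) (by_ : bounded y).

Let a0' : 0 <= a'. Proof. exact: le_trans aa'. Qed.
Let mx' : measurable_fun setT x.
Proof. exact: (measurable_at_measurable hF a0 mx). Qed.
Let my' : measurable_fun setT y.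
Proof. exact: (measurable_at_measurable hF a0' my). Qed.

Let int_past c e : 0 <= c -> c <= e ->
  P.-integrable setT (fun w => (x w * y w * incr c e w)%:E).
Proof.
move=> c0 ce; apply: (@integrable_sqint (fun w => x w * y w * incr c e w)).
under eq_fun do rewrite -mulrA; do 2 apply: bounded_sqintM => //.
exact: sqint_incr.
Qed.

Let meas_past c e : 0 <= c -> c <= e -> a' <= e ->
  measurable_at F e (fun w => x w * y w * incr c e w).
Proof.
move=> c0 ce ae; have e0 : 0 <= e by exact: le_trans ce.
apply: (measurable_atM hF) => //; last exact: measurable_at_incr.
by apply: (measurable_atM hF) => //; [apply: (measurable_at_le hF a0 _ mx);
  exact: le_trans ae|exact: (measurable_at_le hF a0' ae my)].
Qed.

(** The later increment is orthogonal to everything that precedes it. *)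
Lemma ip_term_disjoint : b <= a' ->
  L2ip P (fun w => x w * incr a b w) (fun w => y w * incr a' b' w) = 0.
Proof.
move=> ba'.
have mG : measurable_at F a' (fun w => x w * y w * incr a b w).
  apply: (measurable_atM hF) => //; last exact: (measurable_at_incr a0 (ltW ab)).
  by apply: (measurable_atM hF) => //; exact: (measurable_at_le hF a0 aa' mx).
have [_ <-] := incr_orth a0' (ltW ab') mG (int_past a0 (ltW ab)).
by congr Rintegral; apply/funext => w /=; ring.
Qed.

(** Only the common part of the two increments contributes, through the mean of its
    square; the parts before and after it are orthogonal to the rest. *)
Lemma ip_term_overlap : a' <= b ->
  L2ip P (fun w => x w * incr a b w) (fun w => y w * incr a' b' w) =
  L2ip P x y * (Num.min b b' - a').
Proof.
move=> ab_; set e := Num.min b b'; set M := Num.max b b'.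
have ae : a' <= e by rewrite le_min ab_ ltW.
have e0 : 0 <= e by exact: le_trans ae.
have eM : e <= M by rewrite ge_min le_max lexx.
have [i1 E1] := incr_orth a0' (ltW ab') (meas_past a0 aa' (lexx a')) (int_past a0 aa').
have [i2 E2] := incr_orth e0 eM (meas_past a0' ae ae) (int_past a0' ae).
have mxy : measurable_at F a' (fun w => x w * y w).
  by apply: (measurable_atM hF) => //; exact: (measurable_at_le hF a0 aa' mx).
have ixy : P.-integrable setT (fun w => (x w * y w)%:E).
  by apply: sqint_prod; exact: sqint_bounded.
have [i3 E3] := incr_sqr a0' ae mxy ixy.
have -> : L2ip P x y * (e - a') =
    Rintegral P setT (fun w => x w * y w * incr a' e w ^+ 2) +
    Rintegral P setT (fun w => x w * y w * incr a' e w * incr e M w) +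
    Rintegral P setT (fun w => x w * y w * incr a a' w * incr a' b' w).
  by rewrite E1 E2 E3 !addr0.
rewrite -(RintegralD measurableT i3 i2).
rewrite -(RintegralD measurableT (integrableD measurableT i3 i2) i1).
congr Rintegral; apply/funext => w /=.
by rewrite /e /M /incr; case: (leP b b') => _; ring.
Qed.

End Terms.

Let ip_term_le x y a b a' b' : 0 <= a -> a <= b -> a' <= b' -> a <= a' ->
  (a < b -> measurable_at F a x) -> (a' < b' -> measurable_at F a' y) ->
  bounded x -> bounded y ->
  L2ip P (fun w => x w * incr a b w) (fun w => y w * incr a' b' w) =
  L2ip P x y * overlap a b a' b'.
Proof.
move=> a0 + + aa'; rewrite /overlap (max_idPr aa').
rewrite le_eqVlt => /predU1P[<- ab'|ab].
  rewrite ip_incr_degenerate (_ : Num.max _ _ = 0) ?mulr0// max_l// subr_le0.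
  by rewrite ge_min aa'.
rewrite le_eqVlt => /predU1P[<-|ab'].
  rewrite ipC ip_incr_degenerate (_ : Num.max _ _ = 0) ?mulr0// max_l// subr_le0.
  by rewrite ge_min lexx orbT.
move=> /(_ ab) mx /(_ ab') my bx by_; case: (leP b a') => ba'.
  rewrite ip_term_disjoint// max_l ?mulr0// subr_le0.
  by rewrite ge_min ba'.
rewrite ip_term_overlap ?(ltW ba')// max_r// subr_ge0 le_min.
by rewrite !ltW.
Qed.

(** The Ito isometry for two single steps of simple integrands. Adaptedness is only
    required of nondegenerate steps, which is what truncating at a horizon leaves. *)
Lemma ip_term x y a b a' b' : 0 <= a -> a <= b -> 0 <= a' -> a' <= b' ->
  (a < b -> measurable_at F a x) -> (a' < b' -> measurable_at F a' y) ->
  bounded x -> bounded y ->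
  L2ip P (fun w => x w * incr a b w) (fun w => y w * incr a' b' w) =
  L2ip P x y * overlap a b a' b'.
Proof.
move=> a0 ab a0' ab' mx my bx by_; case: (leP a a') => aa'.
  exact: ip_term_le.
rewrite ipC ip_term_le ?(ltW aa')// ipC; congr (_ * _).
by rewrite /overlap (minC b') (maxC a').
Qed.

End BrownianIncrements.

(** * The Ito integral *)

Section Ito.
Context (K : realType) d (Omega : measurableType d).
Variables (P : probability Omega K) (F : K -> set (set Omega)).
Variable W : K -> Omega -> K.
Hypothesis hF : filtration P F.
Hypothesis hW : brownian_motion P F W.

Notation leb := (@lebesgue_measure K).
Notation mu2 := (leb \x P)%E.
Notation simple := (@simple_process K d Omega F).

(** The integrand restricted to a time interval, as a function on the product space;
    intervals are open on the left so that consecutive ones are disjoint. *)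
Definition rect (a b : K) (Z : K -> Omega -> K) (p : measurableTypeR K * Omega) : K :=
  Z p.1 p.2 * \1_(`]a, b]) p.1.

(** Joint measurability is only available at nonnegative times. *)
Lemma measurable_rect a b Z : 0 <= a ->
  measurable_fun [set p : measurableTypeR K * Omega | 0 <= p.1]
    (fun p : measurableTypeR K * Omega => Z p.1 p.2) ->
  measurable_fun setT (rect a b Z).
Proof.
move=> a0 mZ; set E : set (measurableTypeR K * Omega) := `]a, b] `*` setT.
have mE : measurable E by exact: measurableX.
rewrite (_ : rect a b Z = (fun p => Z p.1 p.2) \_ E).
  apply/(measurable_restrict _ mE measurableT); rewrite setTI.
  apply: measurable_funS mZ => [|[s w] /= [+ _]].
    rewrite (_ : [set p : measurableTypeR K * Omega | 0 <= p.1] =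
      `[0, +oo[ `*` setT); first exact: measurableX.
    by apply/seteqP; split => -[s w]; rewrite /= in_itv/= andbT // => -[].
  by rewrite /= in_itv/= => /andP[/ltW sa _]; exact: le_trans sa.
apply/funext => -[s w]; rewrite /rect patchE /= indicE.
case: ifPn => [|].
  by rewrite inE => -[/= sab _]; rewrite mem_set// mulr1.
rewrite notin_setE => nE; rewrite memNset ?mulr0// => sab.
by apply: nE.
Qed.

Lemma sqint_indic (x : Omega -> K) a b : measurable_fun setT x -> bounded x ->
  sqint mu2 (fun p => x p.2 * \1_(`]a, b]) p.1).
Proof.
move=> mx bx.
have [mx' ix] := sqint_bounded P mx bx.
have m1 : measurable_fun setT (fun s : measurableTypeR K => \1_(`]a, b]) s : K).
  exact: measurable_indic.
split.
  by apply: measurable_funM; [exact: measurableT_comp|exact: (measurableT_comp m1)].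
rewrite (_ : (fun p => _) = (fun p : measurableTypeR K * Omega =>
   (\1_(`]a, b]) p.1 * x p.2 ^+ 2)%:E)).
  apply: (integrable_prod (m1 := leb) (m2 := P) (u := \1_(`]a, b]))
    (v := fun w => x w ^+ 2)) => //.
  exact: integrable_indic_itv.
apply/funext => p; congr EFin; rewrite exprMn mulrC; congr (_ * _).
by rewrite indicE; case: (_ \in _); rewrite ?expr1n ?expr0n.
Qed.

Lemma ip_indic (x y : Omega -> K) a b a' b' :
  measurable_fun setT x -> bounded x -> measurable_fun setT y -> bounded y ->
  L2ip mu2 (fun p => x p.2 * \1_(`]a, b]) p.1) (fun p => y p.2 * \1_(`]a', b']) p.1)
  = L2ip P x y * overlap a b a' b'.
Proof.
move=> mx bx my by_.
have sx := sqint_bounded P mx bx; have sy := sqint_bounded P my by_.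
pose J := `](Num.max a a'), (Num.min b b')]%classic.
have E s : \1_(`]a, b]) s * \1_(`]a', b']) s = \1_J s :> K.
  rewrite /J !indicE -natrM mulnb -in_setI; congr (_ (_ \in _))%:R.
  apply/seteqP; split => r /=; rewrite !in_itv/= gt_max le_min.
    by move=> [/andP[-> ->] /andP[-> ->]].
  by move=> /andP[/andP[-> ->] /andP[-> ->]].
have iJ : leb.-integrable setT (EFin \o (\1_J : K -> K)) by exact: integrable_indic_itv.
have ixy := sqint_prod sx sy.
transitivity (Rintegral leb setT (\1_J : K -> K) * L2ip P x y).
  rewrite -(Rintegral_prod iJ ixy); congr Rintegral; apply/funext => p /=.
  by rewrite -E; ring.
rewrite mulrC; congr (_ * _); rewrite /Rintegral integral_indic; [|exact: measurableT|exact: measurable_itv].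
transitivity (fine (leb J)); first by congr (fine (leb _)); exact: setIT.
have -> : leb J = (if (Num.max a a' < Num.min b b')%R
    then (Num.min b b' - Num.max a a')%:E else 0%E).
  by rewrite [LHS]lebesgue_measure_itv/= lte_fin EFinB.
rewrite /overlap; case: ltP => h /=; apply/esym.
  by apply: max_r; rewrite subr_ge0 ltW.
by apply: max_l; rewrite subr_le0.
Qed.

Section Simple.
Variable H : simple.

Lemma time_ge0 i : 0 <= sp_time H i.
Proof.
by elim: i => [|i]; [exact: sp_time0|move=> /le_trans; apply; exact: sp_time_homo].
Qed.

Lemma coef_meas i : measurable_fun setT (sp_coef H i).
Proof. exact: (measurable_at_measurable hF (time_ge0 i) (sp_coef_meas H i)). Qed.

Lemma sp_valE t : 0 <= t -> rect 0 t (sp_val H) = fun p =>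
  \sum_(i < sp_size H) sp_coef H i p.2 *
     \1_(`]Num.min t (sp_time H i), Num.min t (sp_time H i.+1)]) p.1.
Proof.
move=> t0; apply/funext => -[s w]; rewrite /rect /sp_val mulr_suml.
apply: eq_bigr => i _ /=; rewrite -mulrA; congr (_ * _).
rewrite !indicE -natrM mulnb -in_setI; congr (_ (_ \in _))%:R.
have h0 := time_ge0 i; have h1 := sp_time_homo H i.
apply/seteqP; split => r /=; rewrite !in_itv/= gt_min le_min.
  move=> [/andP[-> ->] /andP[_ ->]]; by rewrite orbT.
move=> /andP[+ /andP[rt rb]]; rewrite ltNge rt /= rb => hr.
by rewrite hr (le_lt_trans h0 hr).
Qed.

(** Truncation at [t] keeps the left end point of a step unless it empties the step. *)
Lemma sp_interval t i : 0 <= t ->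
  let a := Num.min t (sp_time H i) in let b := Num.min t (sp_time H i.+1) in
  [/\ 0 <= a, a <= b & a < b -> measurable_at F a (sp_coef H i)].
Proof.
move=> t0 a b; have h0 := time_ge0 i; have h1 := sp_time_homo H i.
split; first by rewrite le_min t0.
  by rewrite /a /b le_min !ge_min lexx h1 orbT.
move=> ab; rewrite (_ : a = sp_time H i); first exact: sp_coef_meas.
rewrite /a min_r// leNgt; apply/negP => ta.
by move: ab; rewrite /a /b !min_l ?ltxx// ltW// (lt_le_trans ta).
Qed.

Lemma sqint_sp_val t : 0 <= t -> sqint mu2 (rect 0 t (sp_val H)).
Proof.
move=> t0; rewrite sp_valE//; apply: sqint_sum => i.
exact: sqint_indic (coef_meas i) (sp_coef_bounded H i).
Qed.

Lemma sqint_sp_term t i : 0 <= t -> sqint P (fun w =>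
  sp_coef H i w * incr W (Num.min t (sp_time H i)) (Num.min t (sp_time H i.+1)) w).
Proof.
move=> t0; have [a0 ab _] := sp_interval i t0.
apply: bounded_sqintM (coef_meas i) (sp_coef_bounded H i) _.
exact: (sqint_incr hF hW).
Qed.

Lemma sqint_sp_integral t : 0 <= t -> sqint P (sp_integral W H t).
Proof. by move=> t0; apply: sqint_sum => i; exact: sqint_sp_term. Qed.

End Simple.

(** Both sides expand into sums over pairs of steps, whose terms agree. *)
Lemma ip_sp_integral (H H' : simple) t t' : 0 <= t -> 0 <= t' ->
  L2ip P (sp_integral W H t) (sp_integral W H' t') =
  L2ip mu2 (rect 0 t (sp_val H)) (rect 0 t' (sp_val H')).
Proof.
move=> t0 t'0; rewrite !sp_valE// ip_suml//; last 2 first.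
- by move=> i; exact: sqint_sp_term.
- exact: sqint_sp_integral.
rewrite ip_suml//; last 2 first.
- by move=> i; exact: sqint_indic (coef_meas H i) (sp_coef_bounded H i).
- by rewrite -sp_valE//; exact: sqint_sp_val.
apply: eq_bigr => i _; rewrite ip_sumr//; last 2 first.
- by move=> j; exact: sqint_sp_term.
- exact: sqint_sp_term.
rewrite ip_sumr//; last 2 first.
- by move=> j; exact: sqint_indic (coef_meas H' j) (sp_coef_bounded H' j).
- exact: sqint_indic (coef_meas H i) (sp_coef_bounded H i).
apply: eq_bigr => j _.
have [a0 ab ma] := sp_interval H i t0; have [a0' ab' ma'] := sp_interval H' j t'0.
rewrite (ip_term hF hW)//; [|exact: sp_coef_bounded..].
by rewrite ip_indic//; solve [exact: coef_meas | exact: sp_coef_bounded].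
Qed.

(** The part of a step after time [t] is an increment whose coefficient and [G]
    both belong to its past. *)
Lemma ip_term_past (x G : Omega -> K) (a b t t' : K) : 0 <= a -> a <= b ->
  measurable_at F a x -> bounded x -> 0 <= t -> t <= t' ->
  measurable_at F t G -> sqint P G ->
  L2ip P G ((fun w => x w * incr W (Num.min t' a) (Num.min t' b) w) \-
          (fun w => x w * incr W (Num.min t a) (Num.min t b) w)) = 0.
Proof.
move=> a0 ab mx bx t0 tt' mG sG.
have mx' := measurable_at_measurable hF a0 mx.
have zero f : f = cst 0 -> L2ip P G f = 0 by move=> ->; rewrite ipC ip0l.
case: (leP b t) => tb.
  apply: zero; apply/funext => w /=; have at_ := le_trans ab tb.
  by rewrite !min_r ?subrr// (le_trans _ tt').
case: (leP t' a) => at'.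
  apply: zero; apply/funext => w /=; have ta := le_trans tt' at'.
  rewrite !(min_idPl _)// ?(le_trans ta)// ?(le_trans at')//.
  by rewrite /incr; ring.
set u := Num.max t a; set v := Num.min t' b.
have uv : u <= v by rewrite ge_max !le_min tt' (ltW tb) (ltW at') ab.
have u0 : 0 <= u by rewrite le_max t0.
have au : a <= u by rewrite le_max lexx orbT.
have tu : t <= u by rewrite le_max lexx.
have mGx : measurable_at F u (fun w => G w * x w).
  apply: (measurable_atM hF) => //; first exact: (measurable_at_le hF t0 tu mG).
  exact: (measurable_at_le hF a0 au mx).
have iGx : P.-integrable setT (fun w => (G w * x w)%:E).
  by apply: sqint_prod => //; exact: sqint_bounded.
have [_ <-] := incr_orth hF hW u0 uv mGx iGx.
congr Rintegral; apply/funext => w /=.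
rewrite /incr -/v /u.
by case: (leP t a) => _; ring.
Qed.

Lemma ip_sp_integral_past (H : simple) G t t' : 0 <= t -> t <= t' ->
  measurable_at F t G -> sqint P G ->
  L2ip P G (sp_integral W H t') = L2ip P G (sp_integral W H t).
Proof.
move=> t0 tt' mG sG; have t'0 := le_trans t0 tt'.
rewrite ip_sumr//; last by move=> i; exact: sqint_sp_term.
rewrite ip_sumr//; last by move=> i; exact: sqint_sp_term.
apply: eq_bigr => i _.
apply/eqP; rewrite -subr_eq0 -ipBr//; [|exact: sqint_sp_term..].
apply/eqP; apply: ip_term_past => //; [exact: time_ge0|exact: sp_time_homo|
  exact: sp_coef_meas|exact: sp_coef_bounded].
Qed.

Section Integral.
Variables (Y : K -> Omega -> K) (t : K) (I : Omega -> K).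
Hypothesis t0 : 0 <= t.
Hypothesis YI : is_ito_integral P F W Y t I.

Let mY : measurable_fun setT (rect 0 t Y).
Proof. by have [mY _ _ _] := YI; exact: measurable_rect. Qed.

Lemma sqint_integral_rect (Z : K -> Omega -> K) : measurable_fun setT (rect 0 t Z) ->
  (\int[P]_w \int[leb]_(s in `[0%R, t]) (Z s w ^+ 2)%:E =
   \int[mu2]_p (rect 0 t Z p ^+ 2)%:E)%E.
Proof.
move=> mZ; rewrite fubini_tonelli2//=; last 2 first.
- by apply/measurable_EFinP; exact: measurable_funX.
- by move=> p; rewrite lee_fin sqr_ge0.
apply: eq_integral => w _; rewrite /fubini_G /rect /=.
have mw : measurable_fun (`]0, t] : set (measurableTypeR K))
    (fun s : measurableTypeR K => (Z s w ^+ 2)%:E).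
  apply/measurable_EFinP; apply: measurable_funX.
  have : measurable_fun (`]0, t] : set (measurableTypeR K))
    (fun s : measurableTypeR K => rect 0 t Z (s, w)).
    by apply: measurable_funTS; exact: (measurableT_comp mZ).
  apply: eq_measurable_fun => s; rewrite inE /= => s0t.
  by rewrite /rect /= indicE mem_set// mulr1.
rewrite -(integral_itv_obnd_cbnd mw) integral_mkcond.
apply: eq_integral => s _; rewrite patchE indicE.
by case: ifPn => _; rewrite ?mulr1// mulr0 expr0n.
Qed.

(** The iterated integral that measures the approximation of the integrand is, by
    Tonelli, a squared L2 norm over the product space. *)
Lemma ito_approx : exists H : nat -> simple,
  L2cvg P (fun k => sp_integral W (H k) t) I /\
  L2cvg mu2 (fun k => rect 0 t (sp_val (H k))) (rect 0 t Y).
Proof.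
have [_ _ mI [H [cH cI]]] := YI; exists H; split.
  by apply: L2cvgP => // k; exact: sqint_sp_integral.
have sH k := sqint_sp_val (H k) t0.
apply: L2cvgP => //; apply: cvg_trans cH; apply: near_eq_cvg; near=> k.
have E p : rect 0 t (sp_val (H k)) p - rect 0 t Y p =
    rect 0 t (fun s w => sp_val (H k) s w - Y s w) p by rewrite /rect mulrBl.
under eq_integral do rewrite E.
rewrite -sqint_integral_rect//.
rewrite (_ : rect _ _ _ = rect 0 t (sp_val (H k)) \- rect 0 t Y); last first.
  by apply/funext => p; rewrite -E.
apply: measurable_funB => //; exact: (sH k).1.
Unshelve. all: by end_near. Qed.

End Integral.

(** The isometry for simple integrands passes to the limit. The bilinear form, with
    different horizons, also yields the covariance of increments. *)
Lemma ito_isometry Y Y' t t' I I' : 0 <= t -> 0 <= t' ->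
  is_ito_integral P F W Y t I -> is_ito_integral P F W Y' t' I' ->
  L2ip P I I' = L2ip mu2 (rect 0 t Y) (rect 0 t' Y').
Proof.
move=> t0 t'0 YI YI'.
have [H [c1 c2]] := ito_approx t0 YI; have [H' [c1' c2']] := ito_approx t'0 YI'.
have := L2cvg_ip c1 c1'.
under eq_fun do rewrite ip_sp_integral//.
by move=> /cvg_unique; apply => //; exact: L2cvg_ip.
Qed.

Lemma sqint_ito Y t I : 0 <= t -> is_ito_integral P F W Y t I ->
  sqint P I /\ sqint mu2 (rect 0 t Y).
Proof. by move=> t0 /(ito_approx t0)[H [[_ ? _] [_ ? _]]]. Qed.

Lemma L2cvg_cst d' (T : measurableType d') (mu : {measure set T -> \bar K}) f :
  sqint mu f -> L2cvg mu (fun=> f) f.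
Proof.
move=> sf; split => //; rewrite (_ : (fun _ => _) = cst 0); first exact: cvg_cst.
apply/funext => k /=; rewrite (_ : _ \- _ = cst 0) ?nrm0//.
by apply/funext => w /=; rewrite subrr.
Qed.

(** Integrals at two horizons come with unrelated approximations; this estimate
    compares any simple integral with the Ito integral directly. *)
Lemma nrm_sp_ito (H : simple) Y t I : 0 <= t -> is_ito_integral P F W Y t I ->
  L2nrm P (sp_integral W H t \- I) =
  L2nrm mu2 (rect 0 t (sp_val H) \- rect 0 t Y).
Proof.
move=> t0 YI; have [sI sY] := sqint_ito t0 YI.
have [H_ [c1 c2]] := ito_approx t0 YI.
have sH := sqint_sp_integral H t0; have sH' := sqint_sp_val H t0.
have E : L2ip P (sp_integral W H t) I = L2ip mu2 (rect 0 t (sp_val H)) (rect 0 t Y).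
  have := L2cvg_ip (L2cvg_cst sH) c1.
  under eq_fun do rewrite ip_sp_integral//.
  by move=> /cvg_unique; apply => //; exact: L2cvg_ip (L2cvg_cst sH') c2.
congr Num.sqrt; rewrite !ipBl ?ipBr//; try exact: sqintB.
by rewrite (ipC _ I) (ipC _ (rect 0 t Y)) E ip_sp_integral// (ito_isometry t0 t0 YI YI).
Qed.

Lemma nrm_rect_le Z a b a' b' : a' <= a -> b <= b' ->
  measurable_fun setT (rect a b Z) -> sqint mu2 (rect a' b' Z) ->
  sqint mu2 (rect a b Z) /\ L2nrm mu2 (rect a b Z) <= L2nrm mu2 (rect a' b' Z).
Proof.
move=> aa bb mZ sZ; apply: nrm_leP => //; first exact: nrm_ge0.
rewrite -nrm2E//; apply: ge0_le_integral => //.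
- by move=> p _; rewrite lee_fin sqr_ge0.
- by apply/measurable_EFinP; exact: measurable_funX.
- by apply/measurable_EFinP; apply: measurable_funX; exact: sZ.1.
move=> [s w] _; rewrite lee_fin /rect !exprMn /=.
apply: ler_wpM2l; first exact: sqr_ge0.
rewrite !indicE; case: (boolP (s \in `]a, b]%classic)) => [|_]; last by rewrite expr0n sqr_ge0.
rewrite inE /= in_itv/= => /andP[sa sb].
by rewrite mem_set//= in_itv/= (le_lt_trans aa sa) (le_trans sb bb).
Qed.

(** The approximation chosen at [t'] also approximates the integral at [t], and for
    simple integrands the increment after [t] is orthogonal to the past. *)
Lemma ito_martingale Y t t' I I' G : 0 <= t -> t <= t' ->
  is_ito_integral P F W Y t I -> is_ito_integral P F W Y t' I' ->
  measurable_at F t G -> sqint P G -> L2ip P G I' = L2ip P G I.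
Proof.
move=> t0 tt' YI YI' mG sG; have t'0 := le_trans t0 tt'.
have [H [c1 c2]] := ito_approx t0 YI; have [H' [c1' c2']] := ito_approx t'0 YI'.
have [sI sY] := sqint_ito t0 YI; have [sI' sY'] := sqint_ito t'0 YI'.
have l1 := L2cvg_ip (L2cvg_cst sG) c1'.
apply: (cvg_unique _ l1) => //.
rewrite (funext (fun k => ip_sp_integral_past (H' k) t0 tt' mG sG)).
apply: L2cvg_ip (L2cvg_cst sG) _.
split => //; first by move=> k; exact: sqint_sp_integral.
have [_ _ c2''] := c2'; apply/cvgrPdist_le => e e0.
move/cvgrPdist_le : c2'' => /(_ _ e0); apply: filterS => k.
rewrite !sub0r !normrN !ger0_norm ?nrm_ge0// => /(le_trans _); apply.
rewrite (nrm_sp_ito _ t0 YI).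
have E u : rect 0 u (sp_val (H' k)) \- rect 0 u Y =
    rect 0 u (fun s w => sp_val (H' k) s w - Y s w).
  by apply/funext => p; rewrite /rect /= mulrBl.
have sk := sqintB (sqint_sp_val (H' k) t'0) sY'.
have [mk _] := sqintB (sqint_sp_val (H' k) t0) sY.
by move: sk mk; rewrite !E => sk mk; exact: (nrm_rect_le (lexx 0) tt' mk sk).2.
Qed.

End Ito.

(** * Processes with continuous paths *)

Section ContinuousProcess.
Context (K : realType) d (Omega : measurableType d).

Lemma floor_grid (t : K) k : 0 <= t ->
  let u := (Num.truncn (t * k.+1%:R))%:R / k.+1%:R in
  0 <= u /\ `|t - u| <= k.+1%:R^-1.
Proof.
move=> t0 u; have k0 : 0 < k.+1%:R :> K by rewrite ltr0n.
have /andP[l r] : (Num.truncn (t * k.+1%:R))%:R <= t * k.+1%:R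
    < (Num.truncn (t * k.+1%:R)).+1%:R.
  by apply: truncn_itv; rewrite mulr_ge0.
have u1 : u <= t by rewrite ler_pdivrMr.
split; first by rewrite divr_ge0.
rewrite ger0_norm ?subr_ge0// lerBlDr.
have -> : k.+1%:R^-1 + u = (Num.truncn (t * k.+1%:R)).+1%:R / k.+1%:R.
  by rewrite /u -[in RHS]natr1 mulrDl mul1r addrC.
by rewrite ler_pdivlMr// ltW.
Qed.

(** A process with continuous paths is the pointwise limit of its discretizations on
    finer and finer grids, which are countable unions of rectangles. *)
Lemma measurable_continuous_process (Z : K -> Omega -> K) :
  (forall t, 0 <= t -> measurable_fun setT (Z t)) ->
  (forall w, {within `[0, +oo[, continuous (fun t => Z t w)}) ->
  measurable_fun [set p : measurableTypeR K * Omega | 0 <= p.1]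
    (fun p : measurableTypeR K * Omega => Z p.1 p.2).
Proof.
move=> mZ cZ.
set D := [set p : measurableTypeR K * Omega | 0 <= p.1].
have DE : D = `[0, +oo[ `*` setT.
  by apply/seteqP; split => -[s w]; rewrite /D /= in_itv/= andbT // => -[].
have mD : measurable D by rewrite DE; exact: measurableX.
pose g k (t : K) : K := (Num.truncn (t * k.+1%:R))%:R / k.+1%:R.
apply: (measurable_fun_cvg (D := D) (h :=
  fun k (p : measurableTypeR K * Omega) => Z (g k p.1) p.2)).
- move=> k _ B mB.
  rewrite (_ : _ `&` _ = \bigcup_j
    (`[j%:R / k.+1%:R, j.+1%:R / k.+1%:R[ `*` (Z (j%:R / k.+1%:R) @^-1` B))).
    apply: bigcup_measurable => j _; apply: measurableX => //.
    by rewrite -[X in measurable X]setTI; apply: mZ; rewrite ?divr_ge0.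
  have k0 : 0 < k.+1%:R :> K by rewrite ltr0n.
  apply/seteqP; split => -[s w] /=.
    move=> [s0 Bs]; exists (Num.truncn (s * k.+1%:R)) => //; split => //=.
    by rewrite in_itv/= ler_pdivrMr// ltr_pdivlMr// truncn_itv// mulr_ge0.
  move=> [j _ [/=]]; rewrite in_itv/= ler_pdivrMr// ltr_pdivlMr// => sj Bs.
  split; last by rewrite /g (truncn_def sj).
  by case/andP: sj => sj _; rewrite /D /= -(pmulr_lge0 s k0) (le_trans _ sj).
- move=> [t w] t0; rewrite /D /= in t0.
  have /subspace_continuousP/(_ t) := cZ w.
  rewrite /= in_itv/= andbT => /(_ t0) ct.
  apply/cvgrPdist_lt => e e0.
  move/cvgrPdist_lt : ct => /(_ _ e0); rewrite near_withinE => -[r /= r0 hr].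
  near=> k; have [g0 gt] := floor_grid k t0.
  apply: hr => /=; last by rewrite in_itv/= andbT.
  apply: le_lt_trans gt _.
  near: k; exact: near_infty_natSinv_lt (PosNum r0).
Unshelve. all: by end_near. Qed.

End ContinuousProcess.

Section PathCauchySchwarz.
Context {K : realType}.
Notation leb := (@lebesgue_measure K).

Lemma lebesgue_oc (a b : K) : a <= b ->
  leb (`]a, b] : set (measurableTypeR K)) = (b - a)%:E.
Proof.
rewrite le_eqVlt => /predU1P[<-|ab]; rewrite lebesgue_measure_itv/= lte_fin.
  by rewrite ltxx subrr.
by rewrite ab EFinB.
Qed.

(** Cauchy-Schwarz against the indicator of the interval. *)
Lemma path_integral_sqr_le (f : K -> K) (a b c : K) : 0 <= a -> a <= b ->
  {within `[0, +oo[, continuous f} ->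
  ((((Rintegral leb `[0, b] f - Rintegral leb `[0, a] f) - (b - a) * c) ^+ 2)%:E <=
   (b - a)%:E * \int[leb]_(s in `]a, b]) ((f s - c) ^+ 2)%:E)%E.
Proof.
move=> a0 ab cf.
have intf (g : K -> K) u v : 0 <= u -> {within `[0, +oo[, continuous g} ->
    leb.-integrable `[u, v] (EFin \o g).
  move=> u0 cg; apply: continuous_compact_integrable; first exact: segment_compact.
  apply: continuous_subspaceW cg => s /=; rewrite !in_itv/= andbT => /andP[us _].
  exact: le_trans us.
have ifab : leb.-integrable `]a, b] (EFin \o f).
  by apply: integrableS (intf f a b a0 cf) => //; exact: subset_itv_oc_cc.
rewrite Rintegral_itvB//; last exact: intf.
have ic : leb.-integrable `]a, b] (EFin \o (fun=> c)).
  have i2 : leb.-integrable `[a, b] (EFin \o (fun=> c)).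
    by apply: intf => //; apply: continuous_subspaceT => s; exact: cvg_cst.
  by apply: integrableS i2 => //; exact: subset_itv_oc_cc.
have -> : (b - a) * c = Rintegral leb `]a, b] (fun=> c).
  rewrite Rintegral_cst//; transitivity (c * fine (b - a)%:E); first by rewrite mulrC.
  by congr (_ * fine _); apply/esym; exact: lebesgue_oc.
rewrite -RintegralB//.
pose g s := (f s - c) * \1_(`]a, b]) s; pose h s : K := \1_(`]a, b]) s.
have mf : measurable_fun (`]a, b] : set (measurableTypeR K)) f.
  by apply/measurable_EFinP; exact: measurable_int ifab.
have mg : measurable_fun setT g.
  rewrite (_ : g = (fun s => f s - c) \_ `]a, b]).
    apply/(measurable_restrict _ _ measurableT) => //; rewrite setTI.
    exact: measurable_funB.
  apply/funext => s; rewrite /g patchE indicE.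
  by case: ifPn => _; rewrite ?mulr1// mulr0.
have gE : (\int[leb]_s (g s ^+ 2)%:E = \int[leb]_(s in `]a, b]) ((f s - c) ^+ 2)%:E)%E.
  rewrite [RHS]integral_mkcond; apply: eq_integral => s _.
  rewrite /g patchE indicE.
  by case: ifPn => _; rewrite ?mulr1// mulr0 expr0n.
have sg : sqint leb g.
  apply: sqintP => //; rewrite gE.
  have c2 : {within `[0, +oo[, continuous (fun s => (f s - c) * (f s - c))}.
    move=> s.
    by apply: cvgM; apply: cvgB; [exact: cf|exact: cvg_cst|exact: cf|exact: cvg_cst].
  have i2 := intf _ a b a0 c2.
  have : leb.-integrable `]a, b] (EFin \o (fun s => (f s - c) * (f s - c))).
    by apply: integrableS i2 => //; exact: subset_itv_oc_cc.
  move=> /integrableP[_].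
  by under eq_integral do rewrite /= -expr2 ger0_norm ?sqr_ge0//.
have hE s : h s ^+ 2 = h s.
  by rewrite /h indicE; case: (_ \in _); rewrite ?expr1n ?expr0n.
have sh : sqint leb h.
  split; first exact: measurable_indic.
  rewrite (_ : (fun _ => _) = EFin \o h); first exact: integrable_indic_itv.
  by apply/funext => s; rewrite hE.
have nh : L2nrm leb h ^+ 2 = b - a.
  apply: EFin_inj; rewrite -nrm2E//.
  under eq_integral do rewrite hE.
  rewrite integral_indic//; transitivity (leb `]a, b]).
    by congr (leb _); exact: setIT.
  exact: lebesgue_oc.
have -> : Rintegral leb `]a, b] (fun s => f s - c) = L2ip leb g h.
  rewrite Rintegral_mkcond; congr Rintegral; apply/funext => s /=.
  rewrite /g /h patchE indicE.
  by case: ifPn => _; rewrite ?mulr1// mulr0.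
rewrite -gE (nrm2E sg) -EFinM lee_fin -nh.
rewrite -exprMn -[leLHS]real_normK ?num_real// lerXn2r ?nnegrE ?mulr_ge0 ?nrm_ge0//.
by rewrite mulrC; exact: ip_le_nrm.
Qed.

End PathCauchySchwarz.

(** * Bounds over time intervals *)

Section Rectangles.
Context (K : realType) d (Omega : measurableType d) (P : probability Omega K).
Notation leb := (@lebesgue_measure K).
Notation mu2 := (leb \x P)%E.

(** Tonelli: a bound at each time gives a bound over the interval. *)
Lemma nrm_rect_bound Z a b c : a <= b -> 0 <= c ->
  measurable_fun setT (rect a b Z) ->
  (forall s, a < s -> s <= b -> sqint P (Z s) /\ L2nrm P (Z s) <= c) ->
  sqint mu2 (rect a b Z) /\ L2nrm mu2 (rect a b Z) <= Num.sqrt (b - a) * c.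
Proof.
move=> ab c0 mZ hZ; apply: nrm_leP => //; first by rewrite mulr_ge0 ?sqrtr_ge0.
rewrite fubini_tonelli1//=; last 2 first.
- by apply/measurable_EFinP; exact: measurable_funX.
- by move=> p; rewrite lee_fin sqr_ge0.
have -> : ((Num.sqrt (b - a) * c) ^+ 2)%:E =
    (\int[leb]_s ((c ^+ 2)%:E * (\1_(`]a, b]) s)%:E))%E.
  rewrite ge0_integralZl//; last by rewrite lee_fin sqr_ge0.
  rewrite integral_indic//; transitivity ((c ^+ 2)%:E * leb `]a, b])%E; last first.
    by congr (_ * leb _)%E; rewrite setIT.
  rewrite lebesgue_oc// -EFinM exprMn sqr_sqrtr ?subr_ge0//; congr EFin; ring.
  by apply/measurable_EFinP; exact: measurable_indic.
apply: ge0_le_integral => //.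
- by move=> s _; apply: integral_ge0 => w _; rewrite lee_fin sqr_ge0.
- apply: (measurable_fun_fubini_tonelli_F (m2 := P)
    (fun p => (rect a b Z p ^+ 2)%:E)).
    by apply/measurable_EFinP; exact: measurable_funX.
  by move=> p; rewrite lee_fin sqr_ge0.
- apply: measurable_funeM.
  by apply/measurable_EFinP; exact: measurable_indic.
move=> s _; rewrite /fubini_F /rect /= indicE.
case: (boolP (s \in `]a, b]%classic)) => [|_].
  rewrite mule1 inE /= in_itv/= => /andP[sa sb]; have [sZ nZ] := hZ s sa sb.
  under eq_integral do rewrite mulr1.
  by rewrite (nrm2E sZ) lee_fin ler_pXn2r// nnegrE nrm_ge0.
under eq_integral do rewrite mulr0 expr0n.
by rewrite integral0 mule0.
Qed.

Lemma sqint_rect_cst (f : Omega -> K) a b : a <= b -> sqint P f ->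
  sqint mu2 (rect a b (fun=> f)).
Proof.
move=> ab sf; have [] // := @nrm_rect_bound (fun=> f) a b (L2nrm P f) ab (nrm_ge0 _ _).
have m1 : measurable_fun setT (fun s : measurableTypeR K => \1_(`]a, b]) s : K).
  exact: measurable_indic.
apply: measurable_funM; last exact: (measurableT_comp m1).
by apply: measurableT_comp; [exact: sf.1|].
Qed.

Lemma ip_rect_cst (f g : Omega -> K) a b : a <= b -> sqint P f -> sqint P g ->
  L2ip mu2 (rect a b (fun=> f)) (rect a b (fun=> g)) = (b - a) * L2ip P f g.
Proof.
move=> ab sf sg; have ifg := sqint_prod sf sg.
have i1 : leb.-integrable setT (EFin \o (\1_(`]a, b]) : K -> K)).
  exact: integrable_indic_itv.
transitivity (Rintegral leb setT (\1_(`]a, b]) : K -> K) * L2ip P f g).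
  rewrite -(Rintegral_prod i1 ifg); congr Rintegral; apply/funext => p.
  by rewrite /rect /= indicE; case: (_ \in _); rewrite /=; ring.
congr (_ * _); apply: EFin_inj.
rewrite /Rintegral integral_indic// -lebesgue_oc//.
transitivity (fine (leb `]a, b]))%:E; last by rewrite fineK// lebesgue_oc.
by congr (fine (leb _))%:E; exact: setIT.
Qed.

(** A matrix norm that bounds linear combinations by rows and quadratic forms at
    once. *)
Definition abs_sum n (M : 'M[K]_n) : K := \sum_i \sum_j `|M i j|.

Lemma abs_sum_ge0 n (M : 'M[K]_n) : 0 <= abs_sum M.
Proof. by do 2 apply: sumr_ge0 => ? _. Qed.

End Rectangles.

Section LinearCombination.
Context d (T : measurableType d) (K : realType).
Variable mu : {measure set T -> \bar K}.

Lemma nrm_lin n (M : 'M[K]_n) i (h : 'I_n -> T -> K) c :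
  (forall k, sqint mu (h k) /\ L2nrm mu (h k) <= c) ->
  sqint mu (fun x => \sum_k M i k * h k x) /\
  L2nrm mu (fun x => \sum_k M i k * h k x) <= abs_sum M * c.
Proof.
move=> hh; have sh k : sqint mu (fun x => M i k * h k x).
  by apply: sqintZ; exact: (hh k).1.
split; first exact: (sqint_sum _ sh).
apply: le_trans (nrm_sum _ sh) _.
apply: (@le_trans _ _ (\sum_k `|M i k| * c)).
  apply: ler_sum => k _; rewrite nrmZ; last exact: (hh k).1.
  by rewrite ler_wpM2l// (hh k).2.
rewrite -mulr_suml; case: (pickP (fun k : 'I_n => true)) => [k _|n0].
  apply: ler_wpM2r; first exact: le_trans (nrm_ge0 _ _) (hh k).2.
  rewrite /abs_sum [leRHS](bigD1 i)//= lerDl; do 2 apply: sumr_ge0 => ? _.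
  by [].
by have := n0 i.
Qed.

Lemma ip_expand (a b c a' b' c' : T -> K) :
  sqint mu a -> sqint mu b -> sqint mu c ->
  sqint mu a' -> sqint mu b' -> sqint mu c' ->
  L2ip mu ((a \+ b) \+ c) ((a' \+ b') \+ c') =
  (L2ip mu a a' + L2ip mu a b' + L2ip mu a c') + (L2ip mu b a' + L2ip mu b b' + L2ip mu b c')
  + (L2ip mu c a' + L2ip mu c b' + L2ip mu c c').
Proof.
move=> sa sb sc sa' sb' sc'.
have sab := sqintD sa sb; have sab' := sqintD sa' sb'; have s' := sqintD sab' sc'.
rewrite (ipDl sab sc s') (ipDl sa sb s').
by rewrite !(ipDr sab' sc')// !(ipDr sa' sb').
Qed.

End LinearCombination.

(** * Real induction and second moments of the linear equation *)

Section RealInduction.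
Context {K : realType}.

(** The supremum of the times up to which [Q] holds satisfies [Q] by the closure
    hypothesis, and cannot be less than [a] by the extension hypothesis. *)
Lemma real_induction (a : K) (Q : K -> Prop) : Q 0 ->
  (forall t, 0 <= t -> t < a -> Q t ->
     exists2 e, 0 < e & forall h, 0 < h -> h < e -> t + h <= a -> Q (t + h)) ->
  (forall t, 0 < t -> t <= a -> (forall s, 0 <= s -> s < t -> Q s) -> Q t) ->
  forall t, 0 <= t -> t <= a -> Q t.
Proof.
move=> Q0 Qright Qleft t t0 ta.
have a0 := le_trans t0 ta.
pose S := [set u | 0 <= u <= a /\ forall s, 0 <= s -> s <= u -> Q s].
have S0 : S 0.
  split; first by rewrite lexx a0.
  by move=> s s0 s1; rewrite (_ : s = 0)//; apply/eqP; rewrite eq_le s0 s1.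
have supS : has_sup S.
  by split; [exists 0|exists a => u [/andP[]]].
pose c := sup S.
have c0 : 0 <= c by apply: ub_le_sup => //; exact: supS.2.
have ca : c <= a by apply: ge_sup; [exists 0|move=> u [/andP[]]].
have Qlt s : 0 <= s -> s < c -> Q s.
  move=> s0 sc; have [u [_ Qu] su] := sup_gt (ex_intro _ 0 S0) sc.
  by apply: Qu => //; exact: ltW.
have Qc : Q c.
  move: c0; rewrite le_eqVlt => /predU1P[<-//|c0].
  exact: Qleft.
have Sc : S c.
  split; first by rewrite c0 ca.
  move=> s s0; rewrite le_eqVlt => /predU1P[->//|]; exact: Qlt.
suff ac : a <= c by apply: Sc.2 => //; exact: le_trans ac.
rewrite leNgt; apply/negP => ac.
have [e e0 Qe] := Qright c c0 ac Qc.
(* stay inside the extension window and below [a] *)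
pose h := Num.min (e / 2) (a - c).
have h0 : 0 < h by rewrite lt_min divr_gt0//= subr_gt0.
have he : h < e by rewrite gt_min ltr_pdivrMr// mulr_natr mulr2n ltrDl e0.
have ha : c + h <= a by rewrite -lerBrDl ge_min lexx orbT.
have : S (c + h).
  split; first by rewrite addr_ge0// ltW.
  move=> s s0 sch; case: (leP s c) => sc; first exact: Sc.2.
  have -> : s = c + (s - c) by rewrite subrKC.
  apply: Qe; [by rewrite subr_gt0| |by rewrite subrKC (le_trans sch)].
  by apply: le_lt_trans he; rewrite lerBlDl.
move=> /(ub_le_sup supS.2); rewrite -/c leNgt => /negP; apply.
by rewrite ltrDl.
Qed.

(** Increments of order 3/2 are below [e] times the length on short intervals, for
    every [e], so the function grows at most with slope [e]. *)
Lemma nonincreasing_of_small_increments (f : K -> K) (T k : K) : 0 <= T ->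
  (forall t t', 0 <= t -> t <= t' -> t' <= T ->
    f t' - f t <= k * Num.sqrt (t' - t) * (t' - t)) -> f T <= f 0.
Proof.
move=> T0 fk; pose k' := `|k| + 1.
have k'0 : 0 < k' by rewrite ltr_wpDl.
have small e t t' : 0 < e -> 0 <= t -> t <= t' -> t' <= T ->
    t' - t < (e / k') ^+ 2 -> f t' <= f t + e * (t' - t).
  move=> e0 t0 tt' t'T d; rewrite addrC -lerBlDr.
  apply: le_trans (fk _ _ t0 tt' t'T) _.
  apply: ler_wpM2r; first by rewrite subr_ge0.
  have s : Num.sqrt (t' - t) <= e / k'.
    rewrite -(ger0_norm (_ : 0 <= e / k')); last by rewrite divr_ge0// ltW.
    by rewrite -sqrtr_sqr ler_wsqrtr// ltW.
  apply: (@le_trans _ _ (k' * (e / k'))).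
    apply: (@le_trans _ _ (k' * Num.sqrt (t' - t))).
      by rewrite ler_wpM2r ?sqrtr_ge0// (le_trans (ler_norm k))// lerDl.
    by rewrite ler_wpM2l// ltW.
  by rewrite mulrCA divff ?mulr1// gt_eqF.
have main e : 0 < e -> f T <= f 0 + e * T.
  move=> e0; have d0 : 0 < (e / k') ^+ 2 by rewrite exprn_gt0// divr_gt0.
  apply: (@real_induction T (fun t => f t <= f 0 + e * t)) => //.
  - by rewrite mulr0 addr0.
  - move=> t t0 tT ft; exists ((e / k') ^+ 2) => // h h0 hd hT.
    have := small e t (t + h) e0 t0; rewrite lerDl ltW// addrAC subrr add0r.
    move=> /(_ isT hT hd) /le_trans; apply.
    by rewrite mulrDr addrA lerD2r.
  - move=> t t0 tT hs; pose s := Num.max 0 (t - (e / k') ^+ 2 / 2).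
    have s0 : 0 <= s by rewrite le_max lexx.
    have st : s < t by rewrite gt_max t0 ltrBlDr ltrDl divr_gt0.
    have := small e s t e0 s0 (ltW st) tT.
    have ds : t - s < (e / k') ^+ 2.
      have : t - (e / k') ^+ 2 / 2 <= s by rewrite le_max lexx orbT.
      by move: d0; set D := _ ^+ 2 => d0; lra.
    move=> /(_ ds) /le_trans; apply.
    by have := hs s s0 st; rewrite mulrBr; lra.
rewrite leNgt; apply/negP => fT.
pose e := (f T - f 0) / (2 * (T + 1)).
have T1 : 0 < T + 1 by rewrite ltr_wpDl.
have e0 : 0 < e by rewrite divr_gt0 ?subr_gt0// mulr_gt0.
have := main e e0; apply/negP; rewrite -ltNge -ltrBrDl.
apply: (@lt_le_trans _ _ (e * (2 * (T + 1)))).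
  by rewrite ltr_pM2l//; lra.
by rewrite /e divfK// gt_eqF// mulr_gt0.
Qed.

End RealInduction.

Section Moments.
Context (K : realType) d (Omega : measurableType d).
Variables (P : probability Omega K) (F : K -> set (set Omega)).
Variable W : K -> Omega -> K.
Hypothesis hF : filtration P F.
Hypothesis hW : brownian_motion P F W.
Variables (n : nat) (A C : 'M[K]_n) (x : 'cV[K]_n).
Variable X : K -> Omega -> 'cV[K]_n.
Hypothesis hX : sde_solution P F W A C x X.
Notation leb := (@lebesgue_measure K).
Notation mu2 := (leb \x P)%E.
Hypothesis finX : (\int[P]_w \int[leb]_(s in `[0%R, +oo[) (sqnorm (X s w))%:E < +oo)%E.

Definition mxcoord (M : 'M[K]_n) i t w : K := (M *m X t w) i 0.
Let Xc i t w : K := X t w i 0.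

Lemma mxcoordE M i t w : mxcoord M i t w = \sum_k M i k * Xc k t w.
Proof. by rewrite /mxcoord mxE. Qed.

Lemma mxcoord1 i : mxcoord 1%:M i = Xc i.
Proof. by apply/funext => t; apply/funext => w; rewrite /mxcoord mul1mx. Qed.

Lemma measurable_Xc i t : 0 <= t -> measurable_fun setT (Xc i t).
Proof.
move=> t0; have [aX _ _] := hX.
exact: (measurable_at_measurable hF t0 (aX i t t0)).
Qed.

Lemma measurable_mxcoord M i t : 0 <= t -> measurable_fun setT (mxcoord M i t).
Proof.
move=> t0; rewrite (_ : mxcoord M i t = fun w => \sum_k M i k * Xc k t w).
  apply: measurable_sum => k; apply: measurable_funM => //.
  exact: measurable_Xc.
by apply/funext => w; exact: mxcoordE.
Qed.

Lemma continuous_mxcoord M i w :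
  {within `[0, +oo[, continuous (fun t => mxcoord M i t w)}.
Proof.
have [_ cX _] := hX.
have cc : continuous (fun v : 'cV[K]_n => \sum_k M i k * v k 0).
  apply: continuous_big => [|k _ v]; first exact: add_continuous.
  apply: (@continuousM _ _ (fun=> M i k) (fun v : 'cV[K]_n => v k 0)).
    exact: cst_continuous.
  exact: coord_continuous.
rewrite (_ : (fun t => _) = fun t => \sum_k M i k * X t w k 0); last first.
  by apply/funext => t; exact: mxcoordE.
move=> t; exact: (cvg_comp _ _ (cX w t) (cc (X t w))).
Qed.

Lemma measurable_rect_mxcoord M i a b : 0 <= a ->
  measurable_fun setT (rect a b (mxcoord M i)).
Proof.
move=> a0; apply: measurable_rect => //; apply: measurable_continuous_process.
  exact: measurable_mxcoord.
exact: continuous_mxcoord.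
Qed.

Lemma ito_exists : exists It : K -> 'I_n -> Omega -> K, forall t i, 0 <= t ->
  is_ito_integral P F W (mxcoord C i) t (It t i) /\
  {ae P, forall w, Xc i t w =
     x i 0 + Rintegral leb `[0, t] (fun s => mxcoord A i s w) + It t i w}.
Proof.
have [_ _ hI] := hX.
have /choice[I hI'] : forall ti : K * 'I_n, exists I : Omega -> K, 0 <= ti.1 ->
    is_ito_integral P F W (mxcoord C ti.2) ti.1 I /\
    {ae P, forall w, Xc ti.2 ti.1 w =
     x ti.2 0 + Rintegral leb `[0, ti.1] (fun s => mxcoord A ti.2 s w) + I w}.
  move=> [t i] /=; case: (pselect (0 <= t)) => [t0|//]; last by exists (cst 0).
  by have [I ? ?] := hI t i t0; exists I.
by exists (fun t i => I (t, i)) => t i t0; exact: (hI' (t, i) t0).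
Qed.

Let It := projT1 (cid ito_exists).
Let hIt t i : 0 <= t -> is_ito_integral P F W (mxcoord C i) t (It t i).
Proof. by move=> t0; have [] := projT2 (cid ito_exists) t i t0. Qed.
Let hXt t i : 0 <= t -> {ae P, forall w, Xc i t w =
  x i 0 + Rintegral leb `[0, t] (fun s => mxcoord A i s w) + It t i w}.
Proof. by move=> t0; have [] := projT2 (cid ito_exists) t i t0. Qed.

Lemma sqint_It t i : 0 <= t -> sqint P (It t i).
Proof. by move=> t0; exact: (sqint_ito hF hW t0 (hIt i t0)).1. Qed.

(** The L2 norm of the whole process bounds each coordinate over every interval. *)
Let N : K := Num.sqrt (fine
  (\int[P]_w \int[leb]_(s in `[0%R, +oo[) (sqnorm (X s w))%:E)%E).

Let measurable_sqnorm : measurable_fun setT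
  (fun p : measurableTypeR K * Omega =>
     ((sqnorm (X p.1 p.2) * \1_(`[0, +oo[) p.1)%:E)).
Proof.
set E : set (measurableTypeR K * Omega) := `[0, +oo[ `*` setT.
have mE : measurable E by exact: measurableX.
have mX : measurable_fun E (fun p => sqnorm (X p.1 p.2)).
  apply: measurable_sum => i; apply: measurable_funX.
  have := measurable_continuous_process (@measurable_mxcoord 1%:M i)
    (fun w => @continuous_mxcoord 1%:M i w).
  rewrite mxcoord1; apply: measurable_funS.
    rewrite (_ : [set p : measurableTypeR K * Omega | 0 <= p.1] = E)//.
    by apply/seteqP; split => -[s w]; rewrite /E /= in_itv/= andbT // => -[].
  by move=> [s w] [/=]; rewrite in_itv/= andbT.
apply/measurable_EFinP.
rewrite (_ : (fun p => _) = (fun p => sqnorm (X p.1 p.2)) \_ E).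
  by apply/(measurable_restrict _ mE measurableT); rewrite setTI.
apply/funext => -[s w]; rewrite patchE /= indicE.
case: ifPn; rewrite ?inE ?notin_setE /E /= => h.
  by rewrite mem_set ?mulr1//; exact: h.1.
by rewrite memNset ?mulr0// => h'; apply: h.
Qed.

Let finE : (\int[P]_w \int[leb]_(s in `[0%R, +oo[) (sqnorm (X s w))%:E =
  \int[mu2]_p ((sqnorm (X p.1 p.2) * \1_(`[0, +oo[) p.1)%:E))%E.
Proof.
rewrite fubini_tonelli2//=; last first.
  move=> p; rewrite lee_fin mulr_ge0//; apply: sumr_ge0 => i _.
  by rewrite sqr_ge0.
apply: eq_integral => w _; rewrite integral_mkcond; apply: eq_integral => s _.
rewrite patchE /= indicE.
by case: ifPn => _; rewrite ?mulr1 ?mulr0.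
Qed.

Lemma rect_Xc i a b : 0 <= a ->
  sqint mu2 (rect a b (Xc i)) /\ L2nrm mu2 (rect a b (Xc i)) <= N.
Proof.
move=> a0; apply: nrm_leP; last 2 first.
- exact: sqrtr_ge0.
- rewrite sqr_sqrtr ?fine_ge0 ?integral_ge0//; last first.
    move=> w _; apply: integral_ge0 => s _; rewrite lee_fin.
    by apply: sumr_ge0 => j _; rewrite sqr_ge0.
  rewrite fineK; last first.
    rewrite ge0_fin_numE// integral_ge0// => w _; apply: integral_ge0 => s _.
    by rewrite lee_fin; apply: sumr_ge0 => j _; rewrite sqr_ge0.
  rewrite finE; apply: ge0_le_integral => //.
  + by move=> p _; rewrite lee_fin sqr_ge0.
  + apply/measurable_EFinP; apply: measurable_funX.
    by rewrite -mxcoord1; exact: measurable_rect_mxcoord.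
  + move=> [s w] _; rewrite lee_fin /rect /= exprMn.
    have q0 : 0 <= sqnorm (X s w) by apply: sumr_ge0 => j _; rewrite sqr_ge0.
    rewrite !indicE; case: (boolP (s \in `]a, b]%classic)) => [|_]; last first.
      by rewrite expr0n mulr0 mulr_ge0.
    rewrite inE /= in_itv/= => /andP[sa _]; rewrite mem_set/=; last first.
      by rewrite in_itv/= andbT (le_trans a0)// ltW.
    rewrite expr1n !mulr1 /sqnorm (bigD1 i)//= lerDl.
    by apply: sumr_ge0 => j _; rewrite sqr_ge0.
by rewrite -mxcoord1; exact: measurable_rect_mxcoord.
Qed.

Let rect_lin M i a b : rect a b (mxcoord M i) =
  fun p => \sum_k M i k * rect a b (Xc k) p.
Proof.
apply/funext => p; rewrite /rect mxcoordE mulr_suml.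
by apply: eq_bigr => k _; rewrite mulrA.
Qed.

Lemma rect_mxcoord M i a b : 0 <= a ->
  sqint mu2 (rect a b (mxcoord M i)) /\
  L2nrm mu2 (rect a b (mxcoord M i)) <= abs_sum M * N.
Proof. by move=> a0; rewrite rect_lin; apply: nrm_lin => k; exact: rect_Xc. Qed.

(** [J] is the noise part and [V] the drift part of the increment of a coordinate. *)
Let J i t t' : Omega -> K := It t' i \- It t i.
Let V i t t' : Omega -> K := (Xc i t' \- Xc i t) \- J i t t'.

Let sqint_J i t t' : 0 <= t -> t <= t' -> sqint P (J i t t').
Proof. by move=> t0 tt'; apply: sqintB; apply: sqint_It => //; exact: le_trans tt'. Qed.

Let sqint_rectB M i a b (c : Omega -> K) : 0 <= a -> a <= b -> sqint P c ->
  sqint mu2 (rect a b (fun s w => mxcoord M i s w - c w)).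
Proof.
move=> a0 ab sc; rewrite (_ : rect _ _ _ = rect a b (mxcoord M i) \- rect a b (fun=> c)).
  by apply: sqintB; [exact: (rect_mxcoord M i b a0).1|exact: sqint_rect_cst].
by apply/funext => p; rewrite /rect /= mulrBl.
Qed.

(** Almost surely the drift part is a path integral, so Cauchy-Schwarz applies along
    each path. Freezing the integrand at [c] is used with [c = 0] and with its value
    at [t]. *)
Lemma drift_bound i t t' (c : Omega -> K) : 0 <= t -> t <= t' -> sqint P c ->
  sqint P (fun w => V i t t' w - (t' - t) * c w) /\
  L2nrm P (fun w => V i t t' w - (t' - t) * c w) <=
    Num.sqrt (t' - t) * L2nrm mu2 (rect t t' (fun s w => mxcoord A i s w - c w)).
Proof.
move=> t0 tt' sc; have t'0 := le_trans t0 tt'.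
set R := rect t t' _; have sR : sqint mu2 R by exact: sqint_rectB.
have mU : measurable_fun setT (fun w => V i t t' w - (t' - t) * c w).
  apply: measurable_funB.
    apply: measurable_funB; last exact: (sqint_J i t0 tt').1.
    by apply: measurable_funB; exact: measurable_Xc.
  by apply: measurable_funM => //; exact: sc.1.
apply: nrm_leP => //; first by rewrite mulr_ge0 ?sqrtr_ge0 ?nrm_ge0.
rewrite exprMn sqr_sqrtr ?subr_ge0// EFinM -nrm2E//.
have mR2 : measurable_fun setT (fun p => (R p ^+ 2)%:E).
  by apply/measurable_EFinP; apply: measurable_funX; exact: sR.1.
have R20 p : (0 <= (R p ^+ 2)%:E)%E by rewrite lee_fin sqr_ge0.
rewrite fubini_tonelli2// -ge0_integralZl//; last 3 first.
- exact: measurable_fun_fubini_tonelli_G.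
- by move=> w _; apply: integral_ge0.
- by rewrite lee_fin subr_ge0.
apply: ae_ge0_le_integral => //.
- by move=> w _; rewrite lee_fin sqr_ge0.
- by apply/measurable_EFinP; exact: measurable_funX.
- by move=> w _; rewrite mule_ge0 ?lee_fin ?subr_ge0// integral_ge0.
- by apply: measurable_funeM; exact: measurable_fun_fubini_tonelli_G.
apply: filterS2 (hXt i t0) (hXt i t'0) => w Et Et' _.
have -> : V i t t' w - (t' - t) * c w =
    Rintegral leb `[0, t'] (fun s => mxcoord A i s w) -
    Rintegral leb `[0, t] (fun s => mxcoord A i s w) - (t' - t) * c w.
  by rewrite /V /J /= Et Et'; ring.
apply: le_trans (@path_integral_sqr_le _ (fun s => mxcoord A i s w) t t' (c w)
  t0 tt' (@continuous_mxcoord A i w)) _.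
apply: lee_wpmul2l; first by rewrite lee_fin subr_ge0.
rewrite integral_mkcond /fubini_G le_eqVlt; apply/orP; left; apply/eqP.
apply: eq_integral => s _; rewrite patchE /R /rect /= indicE.
by case: ifPn => _; rewrite ?mulr1// mulr0 expr0n.
Qed.

Let drift_bound0 i t t' : 0 <= t -> t <= t' -> sqint P (V i t t') /\
  L2nrm P (V i t t') <= Num.sqrt (t' - t) * L2nrm mu2 (rect t t' (mxcoord A i)).
Proof.
move=> t0 tt'; have := drift_bound i t0 tt' (sqint0 P).
rewrite (_ : (fun w => _ - _) = V i t t'); last first.
  by apply/funext => w; rewrite mulr0 subr0.
rewrite (_ : (fun s w => _ - _) = mxcoord A i)//.
by apply/funext => s; apply/funext => w; rewrite subr0.
Qed.

Let XE i t t' : Xc i t' = (Xc i t \+ V i t t') \+ J i t t'.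
Proof. by apply/funext => w; rewrite /V /=; ring. Qed.

Let rect00 i : rect 0 0 (mxcoord C i) = cst 0.
Proof.
apply/funext => p; rewrite /rect indicE memNset ?mulr0//= in_itv/=.
by move=> /andP[a b]; move: (lt_le_trans a b); rewrite ltxx.
Qed.

Let nrm_It0 i : L2nrm P (It 0 i) = 0.
Proof.
have h0 : (0 : K) <= 0 by [].
rewrite /L2nrm (ito_isometry hF hW h0 h0 (hIt i h0) (hIt i h0)) rect00.
by rewrite ip0l sqrtr0.
Qed.

(** The noise accumulated up to time zero has norm zero by the isometry. *)
Lemma Xc0_ae i : ae_eq P setT (Xc i 0) (cst (x i 0)).
Proof.
have h0 : (0 : K) <= 0 by [].
have s0 := sqint_It i h0.
have I0 : {ae P, forall w, It 0 i w = 0}.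
  have : (\int[P]_w `|(It 0 i w ^+ 2)%:E| = 0)%E.
    under eq_integral do rewrite /= ger0_norm ?sqr_ge0//.
    by rewrite (nrm2E s0) nrm_It0 expr0n.
  have m2 : measurable_fun setT (fun w => (It 0 i w ^+ 2)%:E).
    by apply/measurable_EFinP; apply: measurable_funX; exact: s0.1.
  move/(ae_eq_integral_abs P measurableT m2); apply: filterS => w /(_ Logic.I).
  by move=> [] /eqP; rewrite sqrf_eq0 => /eqP.
apply: filterS2 I0 (hXt i h0) => w I0 -> _; rewrite I0 addr0.
rewrite set_itv1 Rintegral_set1 addr0//.
Qed.

Lemma sqint_Xc0 i : sqint P (Xc i 0).
Proof.
apply: sqint_ae (Xc0_ae i) _; first exact: measurable_Xc.
by apply: sqint_bounded => //; exists `|x i 0|.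
Qed.

Lemma sqint_Xc i t : 0 <= t -> sqint P (Xc i t).
Proof.
move=> t0; rewrite (XE i 0 t).
apply: sqintD; last exact: sqint_J.
by apply: sqintD; [exact: sqint_Xc0|exact: (drift_bound0 i (lexx 0) t0).1].
Qed.

Lemma second_moment0 i j : L2ip P (Xc i 0) (Xc j 0) = x i 0 * x j 0.
Proof.
have sc k : sqint P (cst (x k 0)) by apply: sqint_bounded => //; exists `|x k 0|.
rewrite (ip_ae (Xc0_ae i)) ?sqint_Xc0//; [|exact: sqint_Xc0..].
rewrite ipC (ip_ae (Xc0_ae j)) ?sqint_Xc0//; [|exact: sqint_Xc0].
rewrite ipC /L2ip (_ : _ \* _ = cst (x i 0 * x j 0))//.
rewrite Rintegral_cst// -[RHS]mulr1; congr (_ * _).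
exact: (congr1 (@fine K) (probability_setT P)).
Qed.

(** Polarization of the isometry over the horizons [t] and [t']. *)
Let ip_J i j t t' : 0 <= t -> t <= t' ->
  L2ip P (J i t t') (J j t t') =
  L2ip mu2 (rect t t' (mxcoord C i)) (rect t t' (mxcoord C j)).
Proof.
move=> t0 tt'; have t'0 := le_trans t0 tt'.
have sI k u : 0 <= u -> sqint P (It u k) by exact: sqint_It.
have sR k u v : 0 <= u -> sqint mu2 (rect u v (mxcoord C k)).
  by move=> u0; exact: (rect_mxcoord C k v u0).1.
have rB k : rect t t' (mxcoord C k) =
    rect 0 t' (mxcoord C k) \- rect 0 t (mxcoord C k).
  apply/funext => -[s w]; rewrite /rect /= -mulrBr; congr (_ * _).
  rewrite !indicE !mem_setE /= !in_itv/=.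
  case: (ltP t s) => ts; first by rewrite (le_lt_trans t0 ts) /= subr0.
  by rewrite (le_trans ts tt') subrr.
have ii k l u v : 0 <= u -> 0 <= v -> L2ip P (It u k) (It v l) =
    L2ip mu2 (rect 0 u (mxcoord C k)) (rect 0 v (mxcoord C l)).
  by move=> u0 v0; exact: (ito_isometry hF hW u0 v0 (hIt k u0) (hIt l v0)).
have sIB k : sqint P (It t' k \- It t k) by apply: sqintB; exact: sI.
have sRB k : sqint mu2 (rect 0 t' (mxcoord C k) \- rect 0 t (mxcoord C k)).
  by apply: sqintB; exact: sR.
rewrite !rB !ipBl ?ipBr; try exact: sIB; try exact: sRB; try exact: sI;
  try exact: sR.
by rewrite !ii.
Qed.

Let nrm_J i t t' : 0 <= t -> t <= t' ->
  L2nrm P (J i t t') = L2nrm mu2 (rect t t' (mxcoord C i)).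
Proof. by move=> t0 tt'; rewrite /L2nrm ip_J. Qed.

Let ip_X_J i j t t' : 0 <= t -> t <= t' -> L2ip P (Xc i t) (J j t t') = 0.
Proof.
move=> t0 tt'; have t'0 := le_trans t0 tt'; have [aX _ _] := hX.
rewrite ipBr; [|exact: sqint_It|exact: sqint_It|exact: sqint_Xc].
rewrite (ito_martingale hF hW t0 tt' (hIt j t0) (hIt j t'0)) ?subrr//.
  exact: (aX i t t0).
exact: sqint_Xc.
Qed.

(** The initial value is deterministic, and the drift and the noise over [0, T] are
    controlled by the L2 norm of the whole process. *)
Lemma nrm_X_bounded T : 0 <= T -> exists2 k, 0 <= k &
  forall i t, 0 <= t -> t <= T -> L2nrm P (Xc i t) <= k.
Proof.
move=> T0; pose a := Num.sqrt T * (abs_sum A * N); pose b := abs_sum C * N.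
have N0 : 0 <= N by exact: sqrtr_ge0.
have a0 : 0 <= a by rewrite !mulr_ge0 ?sqrtr_ge0 ?abs_sum_ge0.
have b0 : 0 <= b by rewrite mulr_ge0 ?abs_sum_ge0.
pose c := \sum_i L2nrm P (Xc i 0).
have c0 : 0 <= c by apply: sumr_ge0 => i _; exact: nrm_ge0.
exists (c + a + b) => [|i t t0 tT]; first by rewrite !addr_ge0.
have [sV nV] := drift_bound0 i (lexx 0) t0; have sX := sqint_Xc0 i.
have sJ := sqint_J i (lexx 0) t0.
rewrite (XE i 0 t); apply: le_trans (nrmD (sqintD sX sV) sJ) _.
apply: lerD; last first.
  by rewrite nrm_J//; exact: (rect_mxcoord C i t (lexx 0)).2.
apply: le_trans (nrmD sX sV) _; apply: lerD.
  rewrite /c (bigD1 i)//= lerDl; apply: sumr_ge0 => j _; exact: nrm_ge0.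
apply: le_trans nV _; apply: ler_pM; rewrite ?sqrtr_ge0 ?nrm_ge0//.
  by rewrite subr0 ler_wsqrtr.
exact: (rect_mxcoord A i t (lexx 0)).2.
Qed.

Section Horizon.
Variables (T k : K).
Hypothesis k0 : 0 <= k.
Hypothesis hk : forall i t, 0 <= t -> t <= T -> L2nrm P (Xc i t) <= k.

Let nrm_mxcoord M i t : 0 <= t -> t <= T ->
  sqint P (mxcoord M i t) /\ L2nrm P (mxcoord M i t) <= abs_sum M * k.
Proof.
move=> t0 tT; rewrite (_ : mxcoord M i t = fun w => \sum_k M i k * Xc k t w).
  by apply: nrm_lin => j; split; [exact: sqint_Xc|exact: hk].
by apply/funext => w; exact: mxcoordE.
Qed.

Let rect_short M i t t' : 0 <= t -> t <= t' -> t' <= T ->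
  L2nrm mu2 (rect t t' (mxcoord M i)) <= Num.sqrt (t' - t) * (abs_sum M * k).
Proof.
move=> t0 tt' t'T; apply: (nrm_rect_bound tt' _ (measurable_rect_mxcoord M i t' t0) _).2.
  by rewrite mulr_ge0 ?abs_sum_ge0.
move=> s ts st'; apply: nrm_mxcoord; last exact: le_trans t'T.
exact: le_trans (ltW ts).
Qed.

Let l := (Num.sqrt T * abs_sum A + abs_sum C) * k.
Let l0 : 0 <= l.
Proof. by rewrite mulr_ge0 ?addr_ge0 ?mulr_ge0 ?sqrtr_ge0 ?abs_sum_ge0. Qed.

(** The process is Hoelder continuous of exponent 1/2 in L2: the noise part has this
    order and the drift part is smaller. *)
Let nrm_incr_X i t t' : 0 <= t -> t <= t' -> t' <= T ->
  sqint P (Xc i t' \- Xc i t) /\ L2nrm P (Xc i t' \- Xc i t) <= Num.sqrt (t' - t) * l.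
Proof.
move=> t0 tt' t'T; have t'0 := le_trans t0 tt'.
have [sV nV] := drift_bound0 i t0 tt'; have sJ := sqint_J i t0 tt'.
split; first by apply: sqintB; exact: sqint_Xc.
rewrite (_ : _ \- _ = V i t t' \+ J i t t'); last first.
  by apply/funext => w; rewrite /V /=; ring.
apply: le_trans (nrmD sV sJ) _.
rewrite /l mulrDl mulrDr; apply: lerD; last by rewrite nrm_J// rect_short.
apply: le_trans nV _; apply: ler_wpM2l; first exact: sqrtr_ge0.
apply: le_trans (rect_short A i t0 tt' t'T) _.
rewrite -mulrA; apply: ler_wpM2r; first by rewrite mulr_ge0 ?abs_sum_ge0.
by rewrite ler_wsqrtr// (le_trans _ t'T)// gerBl.
Qed.

Let rect_incr M i t t' : 0 <= t -> t <= t' -> t' <= T ->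
  sqint mu2 (rect t t' (fun s w => mxcoord M i s w - mxcoord M i t w)) /\
  L2nrm mu2 (rect t t' (fun s w => mxcoord M i s w - mxcoord M i t w)) <=
    Num.sqrt (t' - t) * (abs_sum M * (Num.sqrt (t' - t) * l)).
Proof.
move=> t0 tt' t'T; have tT := le_trans tt' t'T.
have sR := sqint_rectB M i t0 tt' (nrm_mxcoord M i t0 tT).1.
split => //; apply: (nrm_rect_bound tt' _ sR.1 _).2.
  by rewrite mulr_ge0 ?abs_sum_ge0// mulr_ge0 ?sqrtr_ge0.
move=> s ts st'; have s0 := le_trans t0 (ltW ts).
rewrite (_ : (fun w => _) = fun w => \sum_k M i k * (Xc k s \- Xc k t) w).
  apply: nrm_lin => j; have [sX nX] := nrm_incr_X j t0 (ltW ts) (le_trans st' t'T).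
  split => //; apply: le_trans nX _; apply: ler_wpM2r => //.
  by rewrite ler_wsqrtr// lerD2r.
apply/funext => w; rewrite !mxcoordE -sumrB; apply: eq_bigr => j _ /=.
by rewrite mulrBr.
Qed.

(** The constant that collects the bounds of the products in the next lemma. *)
Let rem : K := 2 * (k * (abs_sum A * l)) + (abs_sum A * k) ^+ 2 * Num.sqrt T +
  2 * ((abs_sum A * k) * (abs_sum C * k)) + 2 * ((abs_sum C * l) * (abs_sum C * k)).

(** This is the differential form of Ito's formula for second moments. Expanding the
    product of the increments, the noise is orthogonal to the present, the noise
    covariance is given by the isometry, and all other products have order at least
    3/2 because [X] moves by at most the square root of the elapsed time. *)
Lemma second_moment_incr i j t t' : 0 <= t -> t <= t' -> t' <= T ->
  `|L2ip P (Xc i t') (Xc j t') - L2ip P (Xc i t) (Xc j t) -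
    (t' - t) * (L2ip P (mxcoord A i t) (Xc j t) + L2ip P (Xc i t) (mxcoord A j t) +
                L2ip P (mxcoord C i t) (mxcoord C j t))| <=
  rem * Num.sqrt (t' - t) * (t' - t).
Proof.
move=> t0 tt' t'T; have tT := le_trans tt' t'T.
set h := t' - t; set r := Num.sqrt h.
have h0 : 0 <= h by rewrite subr_ge0.
have r0 : 0 <= r by exact: sqrtr_ge0.
have rh : h = r ^+ 2 by rewrite sqr_sqrtr.
have rT : r <= Num.sqrt T by rewrite ler_wsqrtr// /h (le_trans _ t'T)// gerBl.
have sX u : sqint P (Xc u t) by exact: sqint_Xc.
have sV u : sqint P (V u t t') by exact: (drift_bound0 u t0 tt').1.
have sJ u : sqint P (J u t t') by exact: sqint_J.
have sA u : sqint P (mxcoord A u t) by exact: (nrm_mxcoord A u t0 tT).1.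
have sC u : sqint P (mxcoord C u t) by exact: (nrm_mxcoord C u t0 tT).1.
have nX u : L2nrm P (Xc u t) <= k by exact: hk.
have nV u : L2nrm P (V u t t') <= r * (r * (abs_sum A * k)).
  apply: le_trans (drift_bound0 u t0 tt').2 _.
  by apply: ler_wpM2l => //; exact: rect_short.
have nJ u : L2nrm P (J u t t') <= r * (abs_sum C * k).
  by rewrite nrm_J//; exact: rect_short.
pose U u w := V u t t' w - h * mxcoord A u t w.
have sU u : sqint P (U u) by exact: (drift_bound u t0 tt' (sA u)).1.
have nU u : L2nrm P (U u) <= r * (r * (abs_sum A * (r * l))).
  apply: le_trans (drift_bound u t0 tt' (sA u)).2 _.
  by apply: ler_wpM2l => //; exact: (rect_incr A u t0 tt' t'T).2.
pose R u := rect t t' (mxcoord C u); pose S u := rect t t' (fun=> mxcoord C u t).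
have sR u : sqint mu2 (R u) by exact: (rect_mxcoord C u t' t0).1.
have sS u : sqint mu2 (S u) by exact: sqint_rect_cst.
have nR u : L2nrm mu2 (R u) <= r * (abs_sum C * k) by exact: rect_short.
have nS u : L2nrm mu2 (S u) <= r * (abs_sum C * k).
  apply: (nrm_rect_bound tt' _ (sS u).1 _).2; first by rewrite mulr_ge0 ?abs_sum_ge0.
  by move=> s ts st'; exact: nrm_mxcoord.
have [sD nD] : (forall u, sqint mu2 (R u \- S u)) /\
    (forall u, L2nrm mu2 (R u \- S u) <= r * (abs_sum C * (r * l))).
  have E u : R u \- S u = rect t t' (fun s w => mxcoord C u s w - mxcoord C u t w).
    by apply/funext => p; rewrite /R /S /rect /= mulrBl.
  by split=> u; rewrite E; have [] := rect_incr C u t0 tt' t'T.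
have eX u v : L2ip P (Xc u t) (V v t t') = L2ip P (Xc u t) (U v) +
    h * L2ip P (Xc u t) (mxcoord A v t).
  rewrite -ipZr// -ipDr//; last exact: sqintZ.
  by congr L2ip; apply/funext => w; rewrite /U /= subrK.
have eJ u v : L2ip P (J u t t') (J v t t') = L2ip mu2 (R u \- S u) (R v) +
    L2ip mu2 (S u) (R v \- S v) + h * L2ip P (mxcoord C u t) (mxcoord C v t).
  by rewrite ip_J// -(ip_rect_cst tt' (sC u) (sC v)) ipBl ?ipBr//; rewrite /R /S; ring.
have -> : L2ip P (Xc i t') (Xc j t') - L2ip P (Xc i t) (Xc j t) -
    h * (L2ip P (mxcoord A i t) (Xc j t) + L2ip P (Xc i t) (mxcoord A j t) +
         L2ip P (mxcoord C i t) (mxcoord C j t)) =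
   (L2ip P (Xc i t) (U j) + L2ip P (Xc j t) (U i)) + L2ip P (V i t t') (V j t t') +
   (L2ip P (V i t t') (J j t t') + L2ip P (V j t t') (J i t t')) +
   (L2ip mu2 (R i \- S i) (R j) + L2ip mu2 (S i) (R j \- S j)).
  rewrite (XE i t t') (XE j t t').
  rewrite ip_expand//.
  rewrite (ipC _ (J i t t') (Xc j t)) !ip_X_J// eJ eX.
  rewrite (ipC _ (V i t t') (Xc j t)) eX (ipC _ (mxcoord A i t)).
  by rewrite (ipC _ (J i t t') (V j t t')); ring.
rewrite rh.
have b1 u v : `|L2ip P (Xc u t) (U v)| <= k * (r * (r * (abs_sum A * (r * l)))).
  exact: ip_le.
have b2 : `|L2ip P (V i t t') (V j t t')| <=
   (r * (r * (abs_sum A * k))) * (r * (r * (abs_sum A * k))) by exact: ip_le.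
have b3 u v : `|L2ip P (V u t t') (J v t t')| <=
  (r * (r * (abs_sum A * k))) * (r * (abs_sum C * k)) by exact: ip_le.
have b4 : `|L2ip mu2 (R i \- S i) (R j)| <=
  (r * (abs_sum C * (r * l))) * (r * (abs_sum C * k)) by exact: ip_le.
have b5 : `|L2ip mu2 (S i) (R j \- S j)| <=
  (r * (abs_sum C * k)) * (r * (abs_sum C * (r * l))) by exact: ip_le.
have b2' : (r * (r * (abs_sum A * k))) * (r * (r * (abs_sum A * k))) <=
    (abs_sum A * k) ^+ 2 * Num.sqrt T * r ^+ 3.
  rewrite [leLHS](_ : _ = (abs_sum A * k) ^+ 2 * r * r ^+ 3); last by ring.
  apply: ler_wpM2r; first by rewrite exprn_ge0.
  by apply: ler_wpM2l => //; exact: sqr_ge0.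
apply: (@le_trans _ _ (2 * (k * (r * (r * (abs_sum A * (r * l))))) +
  (abs_sum A * k) ^+ 2 * Num.sqrt T * r ^+ 3 +
  2 * ((r * (r * (abs_sum A * k))) * (r * (abs_sum C * k))) +
  2 * ((r * (abs_sum C * (r * l))) * (r * (abs_sum C * k))))); last first.
  by rewrite /rem le_eqVlt; apply/orP; left; apply/eqP; ring.
have tri (u v a b : K) : `|u| <= a -> `|v| <= b -> `|u + v| <= a + b.
  by move=> ua vb; rewrite (le_trans (ler_normD _ _))// lerD.
apply/tri; first (apply/tri; first apply/tri).
- by rewrite mulr_natl mulr2n; apply/tri.
- exact: le_trans b2 b2'.
- by rewrite mulr_natl mulr2n; apply/tri.
- by rewrite mulr_natl mulr2n; apply/tri => //; rewrite mulrC.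
Qed.

End Horizon.

Lemma second_moment_expansion T : 0 <= T -> exists k, forall i j t t',
  0 <= t -> t <= t' -> t' <= T ->
  `|L2ip P (Xc i t') (Xc j t') - L2ip P (Xc i t) (Xc j t) -
    (t' - t) * (L2ip P (mxcoord A i t) (Xc j t) + L2ip P (Xc i t) (mxcoord A j t) +
                L2ip P (mxcoord C i t) (mxcoord C j t))| <=
  k * Num.sqrt (t' - t) * (t' - t).
Proof.
move=> T0; have [k k0 hk] := nrm_X_bounded T0.
by eexists => i j t t'; exact: (second_moment_incr k0 hk).
Qed.

(** Otherwise the integral over the half-line would be infinite. *)
Lemma second_moment_small e : 0 < e ->
  exists2 t, 0 <= t & \sum_i L2nrm P (Xc i t) ^+ 2 < e.
Proof.
move=> e0; apply: contrapT => small.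
(* were the second moment bounded below, so would be the inner integral in time *)
have big t : 0 <= t -> e <= \sum_i L2nrm P (Xc i t) ^+ 2.
  by move=> t0; rewrite leNgt; apply/negP => te; apply: small; exists t.
move: finX; rewrite finE fubini_tonelli1//=; last first.
  move=> p; rewrite lee_fin mulr_ge0//; apply: sumr_ge0 => i _.
  by rewrite sqr_ge0.
apply/negP; rewrite -leNgt.
have -> : (+oo = \int[leb]_(s in `[0%R, +oo[) e%:E)%E.
  have l : leb (`[0%R, +oo[ : set (measurableTypeR K)) = +oo%E.
    by rewrite lebesgue_measure_itv/= ltry oppr0 adde0.
  transitivity (e%:E * leb (`[0%R, +oo[ : set (measurableTypeR K)))%E.
    by rewrite l gt0_muley// lte_fin.
  by apply/esym; exact: (integral_cst leb).
rewrite [leLHS]integral_mkcond.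
apply: ge0_le_integral => //.
- by move=> s _; rewrite patchE; case: ifPn => // _; rewrite lee_fin ltW.
- apply/(measurable_restrict _ _ measurableT) => //.
- apply: (measurable_fun_fubini_tonelli_F (m2 := P)
    (fun p => (sqnorm (X p.1 p.2) * \1_(`[0, +oo[) p.1)%:E)) => //.
  move=> p; rewrite lee_fin mulr_ge0//; apply: sumr_ge0 => i _.
  by rewrite sqr_ge0.
move=> s _; rewrite patchE /fubini_F /= indicE.
case: ifPn => [|_]; last first.
  apply: integral_ge0 => w _; rewrite lee_fin mulr_ge0//.
  by apply: sumr_ge0 => i _; rewrite sqr_ge0.
rewrite inE /= in_itv/= andbT => s0.
under eq_integral do rewrite mulr1 /sqnorm -sumEFin.
rewrite ge0_integral_sum//; last 2 first.
- move=> i; apply/measurable_EFinP; apply: measurable_funX.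
  exact: measurable_Xc.
- by move=> i w _; rewrite lee_fin sqr_ge0.
apply: (@le_trans _ _ (\sum_i L2nrm P (Xc i s) ^+ 2)%:E); first by rewrite lee_fin big.
rewrite -sumEFin; apply: lee_sum => i _.
by rewrite -(nrm2E (sqint_Xc i s0)).
Qed.

End Moments.

(** * Stability and the Lyapunov inequality *)

Lemma bilinear_sum (K : realType) n (M : 'M[K]_n) (u v : 'cV[K]_n) :
  \sum_i \sum_j M i j * (u i 0 * v j 0) = (u^T *m M *m v) 0 0.
Proof.
rewrite mxE exchange_big; apply: eq_bigr => j _; rewrite mxE mulr_suml.
by apply: eq_bigr => i _; rewrite mxE; ring.
Qed.

Lemma Rintegral_sum d (T : measurableType d) (K : realType)
    (mu : {measure set T -> \bar K}) I (s : seq I) (h : I -> T -> K) :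
  (forall i, mu.-integrable setT (EFin \o h i)) ->
  mu.-integrable setT (EFin \o (fun x => \sum_(i <- s) h i x)) /\
  Rintegral mu setT (fun x => \sum_(i <- s) h i x) =
    \sum_(i <- s) Rintegral mu setT (h i).
Proof.
move=> ih; elim: s => [|i s [iI IH]].
  rewrite big_nil (_ : (fun x => _) = cst 0); last first.
    by apply/funext => x; rewrite big_nil.
  by split; [exact: integrable0|rewrite /Rintegral integral0].
rewrite big_cons (_ : (fun x => _) = h i \+ (fun x => \sum_(i <- s) h i x)); last first.
  by apply/funext => x; rewrite big_cons.
by rewrite RintegralD// IH; split => //; exact: (integrableD measurableT (ih i) iI).
Qed.

Lemma sum_ip_le0 d (T : measurableType d) (K : realType)
    (mu : {measure set T -> \bar K}) n (c : 'I_n -> 'I_n -> K)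
    (h : 'I_n -> 'I_n -> T -> K) :
  (forall i j, mu.-integrable setT (EFin \o (h i j))) ->
  (forall x, \sum_i \sum_j c i j * h i j x <= 0) ->
  \sum_i \sum_j c i j * Rintegral mu setT (h i j) <= 0.
Proof.
move=> ih hle.
have ich i j : mu.-integrable setT (EFin \o (fun x => c i j * h i j x)).
  exact: (integrableZl measurableT (c i j) (ih i j)).
have E : \sum_i \sum_j c i j * Rintegral mu setT (h i j) =
    Rintegral mu setT (fun x => \sum_i \sum_j c i j * h i j x).
  have isum i := Rintegral_sum (index_enum 'I_n) (ich i).
  rewrite (Rintegral_sum _ (fun i => (isum i).1)).2.
  apply: eq_bigr => i _; rewrite (isum i).2; apply: eq_bigr => j _.
  by rewrite RintegralZl.
rewrite E -oppr_ge0 -mulN1r -RintegralZl//.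
  by apply: Rintegral_ge0 => x _; rewrite mulN1r oppr_ge0.
have isum i := Rintegral_sum (index_enum 'I_n) (ich i).
exact: (Rintegral_sum _ (fun i => (isum i).1)).1.
Qed.

Section Lyapunov.
Context (K : realType) d (Omega : measurableType d).
Variables (P : probability Omega K) (F : K -> set (set Omega)).
Variable W : K -> Omega -> K.
Hypothesis hF : filtration P F.
Hypothesis hW : brownian_motion P F W.

(** Along the solution from [x], the expectation of the quadratic form of [Delta]
    is nonincreasing, starts from the value at [x] and is arbitrarily small in
    modulus at some times; hence the starting value is nonnegative. *)
Theorem L2_stable_lyapunov n (A C Delta : 'M[K]_n) :
  L2_stable P F W A C ->
  (forall v : 'cV[K]_n,
    (v^T *m (A^T *m Delta + Delta *m A + C^T *m Delta *m C) *m v) 0 0 <= 0) ->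
  forall x : 'cV[K]_n, 0 <= (x^T *m Delta *m x) 0 0.
Proof.
move=> stable Lle0 x; have [X hX finX] := stable x.
pose Xc i t : Omega -> K := fun w => X t w i 0.
have sX i t : 0 <= t -> sqint P (Xc i t) by move=> t0; exact: (sqint_Xc hF hW hX finX).
have sM M i t : 0 <= t -> sqint P (mxcoord X M i t).
  move=> t0; rewrite (_ : mxcoord X M i t = fun w => \sum_k M i k * Xc k t w).
    by apply: sqint_sum => k; apply: sqintZ; exact: sX.
  by apply/funext => w; exact: mxcoordE.
pose phi t := \sum_i \sum_j Delta i j * L2ip P (Xc i t) (Xc j t).
have phi0 : phi 0 = (x^T *m Delta *m x) 0 0.
  rewrite -bilinear_sum; apply: eq_bigr => i _; apply: eq_bigr => j _.
  by rewrite (second_moment0 hF hW hX).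
pose G i j t := L2ip P (mxcoord X A i t) (Xc j t) + L2ip P (Xc i t) (mxcoord X A j t) +
                L2ip P (mxcoord X C i t) (mxcoord X C j t).
(* [G] is the drift of the second moments; against [Delta] it integrates the
   quadratic form of the Lyapunov expression *)
have drift_le0 t : 0 <= t -> \sum_i \sum_j Delta i j * G i j t <= 0.
  move=> t0.
  pose g i j w := mxcoord X A i t w * Xc j t w + Xc i t w * mxcoord X A j t w +
                mxcoord X C i t w * mxcoord X C j t w.
  have i1 i j := sqint_prod (sM A i t t0) (sX j t t0).
  have i2 i j := sqint_prod (sX i t t0) (sM A j t t0).
  have i3 i j := sqint_prod (sM C i t t0) (sM C j t t0).
  have i12 i j := integrableD measurableT (i1 i j) (i2 i j).
  have GE i j : G i j t = Rintegral P setT (g i j).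
    rewrite /G /L2ip -(RintegralD measurableT (i1 i j) (i2 i j)).
    by rewrite -(RintegralD measurableT (i12 i j) (i3 i j)).
  have -> : \sum_i \sum_j Delta i j * G i j t =
      \sum_i \sum_j Delta i j * Rintegral P setT (g i j).
    by apply: eq_bigr => i _; apply: eq_bigr => j _; rewrite GE.
  apply: sum_ip_le0 => [i j|w].
    exact: (integrableD measurableT (i12 i j) (i3 i j)).
  set v := X t w.
  have addE (U V : 'M[K]_1) : (U + V) 0 0 = U 0 0 + V 0 0 by rewrite mxE.
  have vE : v^T *m (A^T *m Delta + Delta *m A + C^T *m Delta *m C) *m v =
      (A *m v)^T *m Delta *m v + v^T *m Delta *m (A *m v) +
      (C *m v)^T *m Delta *m (C *m v).
    by rewrite !trmx_mul !mulmxDr !mulmxDl !mulmxA.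
  have := Lle0 v; rewrite vE !addE -!bilinear_sum -!big_split => /=.
  apply: le_trans; rewrite le_eqVlt; apply/orP; left; apply/eqP.
  apply: eq_bigr => i _; rewrite -!big_split; apply: eq_bigr => j _.
  by rewrite /g /Xc /mxcoord /= -/v; ring.
have mono T : 0 <= T -> phi T <= phi 0.
  move=> T0; have [k hk] := second_moment_expansion hF hW hX finX T0.
  apply: (@nonincreasing_of_small_increments _ phi T (abs_sum Delta * k)) => //.
  move=> t t' t0 tt' t'T.
  pose e i j := L2ip P (Xc i t') (Xc j t') - L2ip P (Xc i t) (Xc j t) - (t' - t) * G i j t.
  have -> : phi t' - phi t = (t' - t) * (\sum_i \sum_j Delta i j * G i j t) +
      \sum_i \sum_j Delta i j * e i j.
    rewrite /phi mulr_sumr -sumrB -big_split; apply: eq_bigr => i _.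
    rewrite /= mulr_sumr -sumrB -big_split; apply: eq_bigr => j _.
    by rewrite /e /=; ring.
  apply: (@le_trans _ _ (0 + \sum_i \sum_j Delta i j * e i j)).
    by rewrite lerD2r mulr_ge0_le0 ?subr_ge0 ?drift_le0.
  rewrite add0r /abs_sum -!mulrA mulr_suml; apply: ler_sum => i _.
  rewrite mulr_suml; apply: ler_sum => j _.
  apply: le_trans (ler_norm _) _; rewrite normrM; apply: ler_wpM2l => //.
  by rewrite mulrA; exact: hk.
have lower T : 0 <= T -> - (abs_sum Delta * \sum_i L2nrm P (Xc i T) ^+ 2) <= phi T.
  move=> T0; set S := \sum_i _; rewrite lerNl /abs_sum mulr_suml -sumrN.
  apply: ler_sum => i _; rewrite mulr_suml -sumrN; apply: ler_sum => j _.
  apply: le_trans (ler_norm _) _; rewrite normrN normrM; apply: ler_wpM2l => //.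
  apply: le_trans (ip_le_nrm (sX i T T0) (sX j T T0)) _.
  have nS k : L2nrm P (Xc k T) ^+ 2 <= S.
    by rewrite /S (bigD1 k)//= lerDl; apply: sumr_ge0 => l _; rewrite sqr_ge0.
  have := nS i; have := nS j; have := sqr_ge0 (L2nrm P (Xc i T) - L2nrm P (Xc j T)).
  by rewrite sqrrB; lra.
rewrite -phi0 leNgt; apply/negP => neg.
pose e := - phi 0 / (abs_sum Delta + 1).
have a0 := abs_sum_ge0 Delta.
have a1 : 0 < abs_sum Delta + 1 by rewrite ltr_wpDl.
have e0 : 0 < e by rewrite divr_gt0// oppr_gt0.
have [T T0 small] := second_moment_small hF hW hX finX e0.
have := le_trans (lower T T0) (mono T T0); apply/negP; rewrite -ltNge ltrNr.
apply: (@le_lt_trans _ _ (abs_sum Delta * e)).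
  by apply: ler_wpM2l => //; exact: ltW.
rewrite (_ : - phi 0 = (abs_sum Delta + 1) * e).
  by rewrite ltr_pM2r// ltrDl.
by rewrite /e mulrCA divff ?mulr1// gt_eqF.
Qed.

End Lyapunov.

(** * Positivity for the Lyapunov differential equation *)

Section QuadraticForms.
Context {K : realType} {n : nat}.
Implicit Types (M N S : 'M[K]_n) (x : 'cV[K]_n).

Definition quad M x : K := (x^T *m M *m x) 0 0.

Lemma quadD M N x : quad (M + N) x = quad M x + quad N x.
Proof. by rewrite /quad mulmxDr mulmxDl mxE. Qed.

Lemma quadZ a M x : quad (a *: M) x = a * quad M x.
Proof. by rewrite /quad -scalemxAr -scalemxAl mxE. Qed.

Lemma quadN M x : quad (- M) x = - quad M x.
Proof. by rewrite -scaleN1r quadZ mulN1r. Qed.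

Lemma quadB M N x : quad (M - N) x = quad M x - quad N x.
Proof. by rewrite quadD quadN. Qed.

Lemma quad1 x : quad 1%:M x = sqnorm x.
Proof.
rewrite /quad mulmx1 mxE /sqnorm; apply: eq_bigr => i _.
by rewrite mxE expr2.
Qed.

Lemma quad_conj m (M : 'M[K]_m) (B : 'M[K]_(m, n)) x :
  quad (B^T *m M *m B) x = ((B *m x)^T *m M *m (B *m x)) 0 0.
Proof. by rewrite /quad trmx_mul !mulmxA. Qed.

Lemma sqnorm_ge0 x : 0 <= sqnorm x.
Proof. by apply: sumr_ge0 => i _; exact: sqr_ge0. Qed.

Lemma quad_le M x : `|quad M x| <= abs_sum M * sqnorm x.
Proof.
rewrite /quad -bilinear_sum /abs_sum mulr_suml.
apply: le_trans (ler_norm_sum _ _ _) _; apply: ler_sum => i _.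
rewrite mulr_suml; apply: le_trans (ler_norm_sum _ _ _) _; apply: ler_sum => j _.
rewrite normrM; apply: ler_wpM2l => //.
have le k : x k 0 ^+ 2 <= sqnorm x.
  by rewrite /sqnorm (bigD1 k)//= lerDl; apply: sumr_ge0 => l _; exact: sqr_ge0.
have := le i; have := le j.
have := sqr_ge0 (x i 0 - x j 0); have := sqr_ge0 (x i 0 + x j 0).
by rewrite sqrrB sqrrD ler_norml => ? ? ? ?; apply/andP; split; lra.
Qed.

End QuadraticForms.

Section LyapunovODE.
Context {K : realType} {n : nat}.
Variables (A C : 'M[K]_n).

Definition lyap (S : 'M[K]_n) : 'M[K]_n :=
  S *m A + A^T *m S + C^T *m S *m C.

Lemma lyapD S S' : lyap (S + S') = lyap S + lyap S'.
Proof.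
rewrite /lyap !mulmxDl !mulmxDr !mulmxDl.
by rewrite [RHS]addrACA; congr (_ + _); rewrite [RHS]addrACA.
Qed.

Lemma lyapZ a S : lyap (a *: S) = a *: lyap S.
Proof. by rewrite /lyap -!scalemxAl -!scalemxAr -!scalemxAl !scalerDr. Qed.

Lemma lyapB S S' : lyap (S - S') = lyap S - lyap S'.
Proof. by rewrite -scaleN1r lyapD lyapZ scaleN1r. Qed.

(** One explicit Euler step for the Lyapunov flow is, up to second order in the step,
    a sum of two congruences, so that it preserves positivity. *)
Lemma quad_euler S h x :
  quad S x + h * quad (lyap S) x =
  quad S (x + h *: (A *m x)) + h * quad S (C *m x) - h ^+ 2 * quad S (A *m x).
Proof.
have -> : quad S (x + h *: (A *m x)) = quad S x + h * quad (S *m A + A^T *m S) x +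
    h ^+ 2 * quad S (A *m x).
  set y := A *m x.
  have -> : quad (S *m A + A^T *m S) x = (x^T *m S *m y) 0 0 + (y^T *m S *m x) 0 0.
    by rewrite quadD /quad /y trmx_mul !mulmxA.
  have tr : (x + h *: y)^T = x^T + h *: y^T by rewrite linearD linearZ.
  rewrite /quad tr !mulmxDl !mulmxDr -!scalemxAl -!scalemxAr.
  have addE (U V : 'M[K]_1) : (U + V) 0 0 = U 0 0 + V 0 0 by rewrite mxE.
  have scE c (U : 'M[K]_1) : (c *: U) 0 0 = c * U 0 0 by rewrite mxE.
  by rewrite !addE !scE; ring.
rewrite /lyap [in LHS]quadD.
have -> : quad (C^T *m S *m C) x = quad S (C *m x).
  by rewrite /quad trmx_mul !mulmxA.
by ring.
Qed.

(** Adding [e * exp (kap t)] times the identity, with [kap] large, makes the right-hand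
    side strictly larger than what the flow requires. This strictness absorbs the
    second-order error of an Euler step, and real induction propagates positivity. *)
Lemma lyapunov_ode_psd (a : K) (Z : K -> 'M[K]_n) (N : 'M[K]_n) :
  (forall x, 0 <= quad (Z 0) x) -> (forall x, 0 <= quad N x) ->
  (forall t e, 0 <= t -> t <= a -> 0 < e -> exists2 r, 0 < r &
     forall t', 0 <= t' -> t' <= a -> `|t' - t| < r -> forall x,
     `|quad (Z t') x - quad (Z t) x - (t' - t) * quad (lyap (Z t) + N) x| <=
       e * `|t' - t| * sqnorm x) ->
  forall t, 0 <= t -> t <= a -> forall x, 0 <= quad (Z t) x.
Proof.
move=> Z0 N0 dZ.
pose kap := abs_sum (lyap 1%:M) + 1.
have main e : 0 < e -> forall t, 0 <= t -> t <= a ->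
    forall x, 0 <= quad (Z t + (e * expR (kap * t)) *: 1%:M) x.
  move=> e0; apply: real_induction.
  - move=> x; rewrite quadD quadZ quad1 addr_ge0// !mulr_ge0 ?expR_ge0 ?sqnorm_ge0//.
    exact: ltW.
  - move=> t t0 ta Qt; set w := e * expR (kap * t).
    have w0 : 0 < w by rewrite mulr_gt0// expR_gt0.
    have [r r0 hr] := dZ t (w / 2) t0 (ltW ta) (divr_gt0 w0 (ltr0Sn _ _)).
    set Y := Z t + w *: 1%:M.
    pose cY := abs_sum (A^T *m Y *m A) + 1.
    have cY0 : 0 < cY by rewrite ltr_wpDl ?abs_sum_ge0.
    exists (Num.min r (w / 2 / cY)); first by rewrite lt_min r0 !divr_gt0.
    move=> h h0; rewrite lt_min => /andP[hr1 hc] ha x.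
    have := hr (t + h) (addr_ge0 t0 (ltW h0)) ha.
    rewrite addrAC subrr add0r gtr0_norm// => /(_ hr1 x).
    rewrite ler_norml => /andP[+ _].
    rewrite quadD [quad (Z (t + h) + _) x]quadD quadZ quad1.
    have Zt : quad (Z t) x = quad Y x - w * sqnorm x.
      by rewrite /Y quadD quadZ quad1 addrK.
    have Lt : quad (lyap (Z t)) x = quad (lyap Y) x - w * quad (lyap 1%:M) x.
      by rewrite /Y lyapD lyapZ quadD quadZ addrK.
    (* the exponential lies above its tangent: this is the gain of order [h] *)
    have grow : w * (1 + kap * h) <= e * expR (kap * (t + h)).
      rewrite [kap * (t + h)]mulrDr expRD mulrA; apply: ler_wpM2l; first exact: ltW.
      exact: expR_ge1Dx.
    have q0 := sqnorm_ge0 x.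
    (* the loss of an Euler step has order [h ^ 2] *)
    have eul : - (h ^+ 2 * (cY * sqnorm x)) <= quad Y x + h * quad (lyap Y) x.
      rewrite quad_euler; apply: (@le_trans _ _ (- (h ^+ 2 * quad Y (A *m x)))).
        rewrite lerN2; apply: ler_wpM2l; first exact: sqr_ge0.
        rewrite -[quad Y _]/(quad Y (A *m x)) /quad -quad_conj.
        apply: le_trans (ler_norm _) _; apply: le_trans (quad_le _ _) _.
        by apply: ler_wpM2r => //; rewrite /cY lerDl.
      by rewrite lerDr addr_ge0 ?mulr_ge0 ?(ltW h0).
    have l1 : quad (lyap 1%:M) x <= (kap - 1) * sqnorm x.
      by rewrite /kap addrK (le_trans (ler_norm _) (quad_le _ _)).
    have hc' : h * cY <= w / 2 by rewrite -ler_pdivlMr// ltW.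
    have Nx := N0 x.
    have f1 : w * h * quad (lyap 1%:M) x <= w * h * ((kap - 1) * sqnorm x).
      by apply: ler_wpM2l => //; rewrite mulr_ge0 ?ltW.
    have f2 : 0 <= h * sqnorm x * (w / 2 - h * cY).
      by rewrite mulr_ge0 ?subr_ge0// mulr_ge0 ?(ltW h0).
    have f3 := ler_wpM2r q0 grow.
    have f4 : 0 <= h * quad N x by rewrite mulr_ge0 ?(ltW h0).
    rewrite Zt Lt => der.
    by clear -f1 f2 f3 f4 der eul; lra.
  - move=> t t0 ta Qs x; rewrite leNgt; apply/negP => neg.
    set g := quad _ x in neg; pose c := - g.
    have c0 : 0 < c by rewrite oppr_gt0.
    have [r r0 hr] := dZ t 1 (ltW t0) ta ltr01.
    pose M := `|quad (lyap (Z t) + N) x| + sqnorm x + 1.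
    have q0 := sqnorm_ge0 x.
    have M0 : 0 < M by rewrite ltr_wpDl// addr_ge0.
    pose dl := Num.min r (c / M) / 2.
    have dl0 : 0 < dl by rewrite divr_gt0// lt_min r0 divr_gt0.
    have dlr : dl < r.
      apply: (@lt_le_trans _ _ (Num.min r (c / M))); last by rewrite ge_min lexx.
      by rewrite ltr_pdivrMr// mulr_natr mulr2n ltrDl; move: dl0; rewrite /dl; lra.
    have dlc : dl * M < c.
      rewrite -ltr_pdivlMr//.
      apply: (@lt_le_trans _ _ (Num.min r (c / M))).
        by rewrite ltr_pdivrMr// mulr_natr mulr2n ltrDl; move: dl0; rewrite /dl; lra.
      by rewrite ge_min lexx orbT.
    pose s := Num.max 0 (t - dl).
    have s0 : 0 <= s by rewrite le_max lexx.
    have st : s < t by rewrite gt_max t0 ltrBlDr ltrDl.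
    have ts : t - s <= dl by rewrite lerBlDr -lerBlDl le_max lexx orbT.
    have Ns : `|s - t| = t - s by rewrite distrC gtr0_norm// subr_gt0.
    have := hr s s0 (le_trans (ltW st) ta).
    rewrite Ns => /(_ (le_lt_trans ts dlr) x).
    rewrite ler_norml => /andP[_ up].
    have := Qs s s0 st x; rewrite quadD quadZ quad1 => gs.
    have ex : e * expR (kap * s) * sqnorm x <= e * expR (kap * t) * sqnorm x.
      apply: ler_wpM2r => //; apply: ler_wpM2l; first exact: ltW.
      rewrite ler_expR; apply: ler_wpM2l; last exact: ltW.
      by rewrite addr_ge0 ?abs_sum_ge0.
    have gE : g = quad (Z t) x + e * expR (kap * t) * sqnorm x.
      by rewrite /g quadD quadZ quad1.
    have f1 : (s - t) * quad (lyap (Z t) + N) x <= (t - s) * `|quad (lyap (Z t) + N) x|.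
      rewrite -(opprB t) mulNr -mulrN; apply: ler_wpM2l; first by rewrite subr_ge0 ltW.
      by rewrite -normrN ler_norm.
    have f2 : (t - s) * M <= dl * M by apply: ler_wpM2r => //; exact: ltW.
    have ts0 : 0 < t - s by rewrite subr_gt0.
    by move: f2; rewrite /M => f2; clear -f1 f2 ex gE gs up dlc ts0; rewrite /c /M in dlc; nra.
move=> t t0 ta x; rewrite leNgt; apply/negP => neg.
have q0 := sqnorm_ge0 x; set E := expR (kap * t).
have E0 : 0 <= E * sqnorm x by rewrite mulr_ge0 ?expR_ge0.
pose c := - quad (Z t) x; have c0 : 0 < c by rewrite oppr_gt0.
have d0 : 0 < 2 * (E * sqnorm x + 1) by rewrite mulr_gt0// ltr_wpDl.
have := main _ (divr_gt0 c0 d0) t t0 ta x.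
rewrite quadD quadZ quad1 -/E; apply/negP; rewrite -ltNge -[quad (Z t) x]opprK -/c.
rewrite addrC subr_lt0 -mulrA mulrAC ltr_pdivrMr//.
by rewrite ltr_pM2l//; lra.
Qed.

End LyapunovODE.

(** * The delayed equation and completion of the square *)

Section DelayedRiccati.
Context {K : realType} {n : nat}.

(** Convergence of the difference quotients in matrix space controls the quadratic
    forms uniformly over the unit sphere. *)
Lemma quad_derivative (T s : K) (Sigma : K -> 'M[K]_n) (D : 'M[K]_n) :
  (fun r => (r - s)^-1 *: (Sigma r - Sigma s)) @ within `[0, T] s^' --> D ->
  forall e, 0 < e -> exists2 r, 0 < r & forall t, 0 <= t -> t <= T ->
    `|t - s| < r -> forall x,
    `|quad (Sigma t) x - quad (Sigma s) x - (t - s) * quad D x| <=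
      e * `|t - s| * sqnorm x.
Proof.
move=> cD e e0; pose e' := e / (n%:R * n%:R + 1).
have nn0 : 0 < n%:R * n%:R + 1 :> K by rewrite ltr_wpDl// mulr_ge0.
have e'0 : 0 < e' by rewrite divr_gt0.
move/cvg_ballP : cD => /(_ e' e'0); rewrite near_withinE.
move=> /nbhs_ballP[r /= r0 hr]; exists r => // t t0 tT tr x.
have [->|ts] := eqVneq t s.
  by rewrite !subrr mul0r subrr normr0 mulr0 mul0r.
have ts0 : t - s != 0 by rewrite subr_eq0.
have := hr t; rewrite /ball /= distrC => /(_ tr ts); rewrite in_itv/= t0 tT.
move=> /(_ isT) hb; pose E := (t - s)^-1 *: (Sigma t - Sigma s) - D.
have Eb i j : `|E i j| <= e'.
  have [_ /(_ i j)] := hb; rewrite /ball /= => /ltW.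
  by rewrite distrC /E !mxE.
have aE : abs_sum E <= e.
  apply: (@le_trans _ _ (\sum_(i < n) \sum_(j < n) e')).
    by apply: ler_sum => i _; apply: ler_sum => j _.
  rewrite !sumr_const !card_ord -mulrnA -mulr_natr natrM.
  rewrite /e' mulrAC ler_pdivrMr// ler_pM2l//; lra.
have -> : quad (Sigma t) x - quad (Sigma s) x - (t - s) * quad D x = (t - s) * quad E x.
  rewrite /E quadB quadZ quadB; field.
  by [].
rewrite normrM mulrC mulrAC; apply: ler_wpM2r => //.
apply: le_trans (quad_le _ _) _; apply: ler_wpM2r aE.
exact: sqnorm_ge0.
Qed.

(** Reversing time gives a forward equation started at zero, so the solution is
    nonnegative. The difference of two time shifts solves the homogeneous equation
    with nonnegative initial value, so the solution decreases with time; its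
    derivative at zero is then nonpositive. *)
Lemma lyapunov_backward (T : K) (A C N : 'M[K]_n) (Sigma : K -> 'M[K]_n) : 0 < T ->
  (forall x, 0 <= quad N x) ->
  (forall s, 0 <= s <= T -> exists2 D : 'M[K]_n,
     (fun r => (r - s)^-1 *: (Sigma r - Sigma s)) @ within `[0, T] s^' --> D &
     D = - (lyap A C (Sigma s) + N)) ->
  Sigma T = 0 ->
  (forall x, 0 <= quad (Sigma 0) x) /\
  (forall x, 0 <= quad (lyap A C (Sigma 0) + N) x).
Proof.
move=> T0 N0 dS ST.
have der s e : 0 <= s -> s <= T -> 0 < e -> exists2 r, 0 < r & forall t, 0 <= t -> t <= T ->
    `|t - s| < r -> forall x,
    `|quad (Sigma t) x - quad (Sigma s) x + (t - s) * quad (lyap A C (Sigma s) + N) x|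
      <= e * `|t - s| * sqnorm x.
  move=> s0 sT e0; have [|D cD DE] := dS s; first by rewrite s0 sT.
  have [r r0 hr] := quad_derivative cD e0; exists r => // t t0 tT tr x.
  by have := hr t t0 tT tr x; rewrite DE quadN mulrN opprK.
have pos s : 0 <= s -> s <= T -> forall x, 0 <= quad (Sigma s) x.
  move=> s0 sT; have -> : s = T - (T - s) by rewrite subKr.
  apply: (lyapunov_ode_psd (A := A) (C := C) (a := T) (Z := fun t => Sigma (T - t))
    (N := N)) => //.
  - by move=> x; rewrite subr0 ST /quad mulmx0 mul0mx mxE.
  - move=> t e t0 tT e0; have [||r r0 hr] := der (T - t) e _ _ e0.
    + by rewrite subr_ge0.
    + by rewrite gerBl.
    exists r => // t' t'0 t'T tr x.
    have E : (T - t') - (T - t) = - (t' - t) by ring.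
    have := hr (T - t'); rewrite E normrN subr_ge0 gerBl => /(_ t'T t'0 tr x).
    by rewrite mulNr.
  - by rewrite subr_ge0.
  - by rewrite gerBl.
split; first by apply: pos => //; exact: ltW.
(* the shifted difference [Z] starts at [Sigma (T - h)], since [Sigma T = 0] *)
have mono h : 0 < h -> h < T -> forall x, 0 <= quad (Sigma 0 - Sigma h) x.
  move=> h0 hT; pose Z t := Sigma (T - h - t) - Sigma (T - t).
  have -> : Sigma 0 - Sigma h = Z (T - h) by rewrite /Z subrr subKr.
  apply: (lyapunov_ode_psd (A := A) (C := C) (a := T - h) (Z := Z) (N := 0)) => //.
  - move=> x; rewrite /Z !subr0 ST subr0; apply: pos.
      by rewrite subr_ge0 ltW.
    by rewrite gerBl ltW.
  - by move=> x; rewrite /quad mulmx0 mul0mx mxE.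
  - move=> t e t0 tT e0; have e20 : 0 < e / 2 by rewrite divr_gt0.
    have [||r1 r10 hr1] := der (T - h - t) _ _ _ e20; [lra..|].
    have [||r2 r20 hr2] := der (T - t) _ _ _ e20; [lra..|].
    exists (Num.min r1 r2); first by rewrite lt_min r10.
    move=> t' t'0 t'T; rewrite lt_min => /andP[tr1 tr2] x.
    have E1 : (T - h - t') - (T - h - t) = - (t' - t) by ring.
    have E2 : (T - t') - (T - t) = - (t' - t) by ring.
    have := hr1 (T - h - t'); rewrite E1 normrN.
    have -> : 0 <= T - h - t' by lra.
    have -> : T - h - t' <= T by lra.
    move=> /(_ isT isT tr1 x) b1.
    have := hr2 (T - t'); rewrite E2 normrN.
    have -> : 0 <= T - t' by lra.
    have -> : T - t' <= T by lra.
    move=> /(_ isT isT tr2 x) b2.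
    rewrite addr0 /Z lyapB !quadB.
    move: b1 b2; rewrite !quadD !mulNr => b1 b2.
    have := lerD b1 b2; rewrite -[X in _ + X <= _]normrN => b3.
    apply: (le_trans _ (le_trans b3 _)); last by lra.
    by apply: le_trans (ler_normD _ _); rewrite le_eqVlt; apply/orP; left; apply/eqP;
      congr `|_|; ring.
  - by rewrite subr_ge0 ltW.
move=> x; rewrite leNgt; apply/negP; set q := quad _ x => neg.
have s0 := sqnorm_ge0 x.
pose e := - q / (2 * (sqnorm x + 1)).
have d0 : 0 < 2 * (sqnorm x + 1) by rewrite mulr_gt0// ltr_wpDl.
have e0 : 0 < e by rewrite divr_gt0// oppr_gt0.
have [r r0 hr] := der 0 e (lexx 0) (ltW T0) e0.
pose h := Num.min r T / 2.
have h0 : 0 < h by rewrite divr_gt0// lt_min r0.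
have h2 : h < Num.min r T by move: h0; rewrite /h; lra.
move: h2; rewrite lt_min => /andP[h_r hT].
have := hr h (ltW h0) (ltW hT); rewrite subr0 gtr0_norm// => /(_ h_r x).
rewrite -/q ler_norml => /andP[low _].
have := mono h h0 hT x; rewrite quadB => m.
have low' : - (e * sqnorm x) <= q.
  by rewrite -(ler_pM2l h0); lra.
have eq : e * (2 * (sqnorm x + 1)) = - q by rewrite /e divfK// gt_eqF.
nra.
Qed.

End DelayedRiccati.

Section CompletingTheSquare.
Context {K : realType} {n m : nat}.
Variables (A C : 'M[K]_n) (B D : 'M[K]_(n, m)) (Q : 'M[K]_n) (R : 'M[K]_m).
Variable S : 'M[K]_n.
Hypothesis symS : S^T = S.
Hypothesis symR : R^T = R.

Let RS := R + D^T *m S *m D.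
Let G := B^T *m S + D^T *m S *m C.
Hypothesis unitRS : RS \in unitmx.

Definition riccati_lhs : 'M[K]_n :=
  A^T *m S + S *m A + C^T *m S *m C + Q - G^T *m invmx RS *m G.

Let symRS : RS^T = RS.
Proof. by rewrite /RS linearD /= !trmx_mul trmxK symS symR !mulmxA. Qed.

Let addE (U V : 'M[K]_1) : (U + V) 0 0 = U 0 0 + V 0 0.
Proof. by rewrite mxE. Qed.

Let dot k (u v : 'cV[K]_k) : K := (u^T *m v) 0 0.

Let dotC k (u v : 'cV[K]_k) : dot u v = dot v u.
Proof.
rewrite /dot -[in RHS](trmxK u) -trmx_mul.
by rewrite [in RHS]mxE.
Qed.

Let dotDl k (u u' v : 'cV[K]_k) : dot (u + u') v = dot u v + dot u' v.
Proof. by rewrite /dot linearD /= mulmxDl addE. Qed.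

Let dotDr k (u u' v : 'cV[K]_k) : dot v (u + u') = dot v u + dot v u'.
Proof. by rewrite /dot mulmxDr addE. Qed.

Let dot_adj k l (M : 'M[K]_(k, l)) u v : dot u (M *m v) = dot (M^T *m u) v.
Proof. by rewrite /dot trmx_mul trmxK mulmxA. Qed.

Let quad_dot k (M : 'M[K]_k) u : quad M u = dot u (M *m u).
Proof. by rewrite /quad /dot mulmxA. Qed.

(** The gain is the critical point of the left-hand side as a quadratic function of
    [Theta], and the Riccati expression is its critical value. *)
Lemma complete_square (Theta : 'M[K]_(m, n)) x :
  quad (lyap (A + B *m Theta) (C + D *m Theta) S + (Q + Theta^T *m R *m Theta)) x =
  quad riccati_lhs x + quad RS ((Theta - gain C B D R S) *m x).
Proof.
set y := Theta *m x; pose w := G *m x; pose g := invmx RS *m w.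
have RSg : RS *m g = w by rewrite /g mulmxA mulmxV// mul1mx.
have -> : (Theta - gain C B D R S) *m x = y + g.
  by rewrite /gain opprK mulmxDl /g /w !mulmxA.
have wE : w = B^T *m (S *m x) + D^T *m (S *m (C *m x)).
  by rewrite /w /G mulmxDl !mulmxA.
have Ax : (A + B *m Theta) *m x = A *m x + B *m y by rewrite mulmxDl /y mulmxA.
have Cx : (C + D *m Theta) *m x = C *m x + D *m y by rewrite mulmxDl /y mulmxA.
have SC k l (M : 'M[K]_(n, k)) (M' : 'M[K]_(n, l)) u v :
    dot (S *m (M *m u)) (M' *m v) = dot (M *m u) (S *m (M' *m v)).
  by rewrite [RHS]dot_adj symS.
have yw : dot y w = dot (B *m y) (S *m x) + dot (D *m y) (S *m (C *m x)).
  by rewrite wE dotDr !(dot_adj _^T) !trmxK.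
have gw : dot g w = dot w g by exact: dotC.
have -> : quad (lyap (A + B *m Theta) (C + D *m Theta) S +
    (Q + Theta^T *m R *m Theta)) x =
    2 * dot (A *m x + B *m y) (S *m x) +
    dot (C *m x + D *m y) (S *m (C *m x + D *m y)) + quad Q x + quad R y.
  rewrite /lyap !quadD.
  have -> : quad (S *m (A + B *m Theta)) x = dot (A *m x + B *m y) (S *m x).
    by rewrite quad_dot -mulmxA Ax dot_adj symS dotC.
  have -> : quad ((A + B *m Theta)^T *m S) x = dot (A *m x + B *m y) (S *m x).
    by rewrite quad_dot -mulmxA dot_adj trmxK Ax.
  have -> : quad ((C + D *m Theta)^T *m S *m (C + D *m Theta)) x =
      dot (C *m x + D *m y) (S *m (C *m x + D *m y)).
    by rewrite quad_dot -!mulmxA Cx dot_adj trmxK Cx.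
  have -> : quad (Theta^T *m R *m Theta) x = quad R y.
    by rewrite quad_dot -!mulmxA dot_adj trmxK -quad_dot.
  by ring.
have -> : quad riccati_lhs x = 2 * dot (A *m x) (S *m x) +
    dot (C *m x) (S *m (C *m x)) + quad Q x - dot w g.
  rewrite /riccati_lhs quadB !quadD.
  have -> : quad (A^T *m S) x = dot (A *m x) (S *m x).
    by rewrite quad_dot -mulmxA dot_adj trmxK.
  have -> : quad (S *m A) x = dot (A *m x) (S *m x).
    by rewrite quad_dot -mulmxA dot_adj symS dotC.
  have -> : quad (C^T *m S *m C) x = dot (C *m x) (S *m (C *m x)).
    by rewrite quad_dot -!mulmxA dot_adj trmxK.
  have -> : quad (G^T *m invmx RS *m G) x = dot w g.
    by rewrite quad_dot -!mulmxA dot_adj trmxK.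
  by ring.
have -> : quad RS (y + g) = quad R y + dot (D *m y) (S *m (D *m y)) +
    2 * dot y w + dot w g.
  rewrite quad_dot mulmxDr RSg !dotDl !dotDr gw.
  have -> : dot y (RS *m y) = quad R y + dot (D *m y) (S *m (D *m y)).
    rewrite -quad_dot /RS quadD; congr (_ + _).
    by rewrite quad_dot -!mulmxA dot_adj trmxK.
  have -> : dot g (RS *m y) = dot y w by rewrite dot_adj symRS RSg dotC.
  by ring.
rewrite yw !mulmxDr !dotDl !dotDr.
have -> : dot (C *m x) (S *m (D *m y)) = dot (D *m y) (S *m (C *m x)).
  by rewrite dot_adj symS dotC.
by ring.
Qed.

End CompletingTheSquare.

(** * Comparison with the static solution *)

Theorem proposition4p10 (K : realType) (d : measure_display)
    (Omega : measurableType d) (Pr : probability Omega K)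
    (F : K -> set (set Omega)) (W : K -> Omega -> K)
    (n m : nat) (T : K) (A C : 'M[K]_n) (B D : 'M[K]_(n, m))
    (Q : 'M[K]_n) (R : 'M[K]_m) (Sigma : K -> 'M[K]_n) (Pinf : 'M[K]_n)
    (hF : filtration Pr F) (hW : brownian_motion Pr F W)
    (hT : 0 < T) (hQ : psd Q) (hR : posdef R)
    (hstab : L2_stabilizable Pr F W A C B D)
    (hSigma : delayed_riccati_solution A C B D Q R T Sigma)
    (hPinf : static_stabilizing_solution A C B D Q R Pr F W Pinf) :
  loewner_le 0 (Sigma 0) /\ loewner_le (Sigma 0) Pinf.
Proof.
have [symQ Q0] := hQ; have [symR Rpos] := hR.
have [symSigma unitS dSigma ST] := hSigma.
have [symP unitP ricP stabP] := hPinf.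
have R0 y : 0 <= quad R y.
  have [->|y0] := eqVneq y 0; first by rewrite /quad mulmx0 mxE.
  exact: ltW (Rpos y y0).
have symS : (Sigma 0)^T = Sigma 0 by apply: symSigma; rewrite lexx ltW.
set Psi := gain C B D R (Sigma 0) in dSigma.
pose N := Q + Psi^T *m R *m Psi.
have N0 x : 0 <= quad N x.
  by rewrite quadD addr_ge0 ?quad_conj//; [exact: Q0|exact: R0].
(* [Sigma] solves a Lyapunov equation for the constant feedback [Psi] *)
have [S0 L0] : (forall x, 0 <= quad (Sigma 0) x) /\
    (forall x, 0 <= quad (lyap (A + B *m Psi) (C + D *m Psi) (Sigma 0) + N) x).
  apply: (lyapunov_backward hT N0 _ ST) => s sT.
  have [dS cdS eqS] := dSigma s sT; exists dS => //.
  by apply/eqP; rewrite -addr_eq0 /lyap /N !addrA; apply/eqP.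
have RS0 y : 0 <= quad (R + D^T *m Sigma 0 *m D) y.
  by rewrite quadD addr_ge0 ?quad_conj//; exact: S0.
(* [Psi] is the gain of [Sigma 0], so the square vanishes: [Sigma 0] is a
   subsolution of the algebraic Riccati equation *)
have ric0 x : 0 <= quad (riccati_lhs A C B D Q R (Sigma 0)) x.
  have := L0 x; rewrite (complete_square A C B Q symS symR unitS).
  by rewrite -/Psi subrr mul0mx /quad mulmx0 [X in _ + X]mxE addr0.
split; first by rewrite /loewner_le subr0; split.
(* at [Theta] the square for [Pinf] vanishes and the one for [Sigma 0] is nonnegative *)
set Theta := gain C B D R Pinf in stabP.
split; first by rewrite linearB /= symP symS.
apply: (L2_stable_lyapunov hF hW stabP) => v.
have sqP := complete_square A C B Q symP symR unitP Theta v.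
have sqS := complete_square A C B Q symS symR unitS Theta v.
have ricP0 : quad (riccati_lhs A C B D Q R Pinf) v = 0.
  by rewrite /riccati_lhs ricP /quad mulmx0 mul0mx mxE.
rewrite -/Theta ricP0 subrr mul0mx in sqP.
rewrite [X in X <= 0](_ : _ =
  quad (lyap (A + B *m Theta) (C + D *m Theta) (Pinf - Sigma 0)) v); last first.
  by rewrite /quad /lyap [(_ - _) *m (A + _) + _]addrC.
have z : quad (R + D^T *m Pinf *m D) (0 : 'cV[K]_m) = 0.
  by rewrite /quad mulmx0 mxE.
rewrite z addr0 quadD in sqP; rewrite quadD in sqS.
have := ric0 v; have := RS0 ((Theta - gain C B D R (Sigma 0)) *m v).
by rewrite lyapB quadB; lra.
Qed.
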